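(* Assume the Setting and Shooting problem below, and that $g$ satisfies (H1) and (H2); let $\beta$ be as in the Setting. Then there exists $\gamma_0>0$ such that for all $\gamma>\gamma_0$, $$y'(T(\gamma),\gamma)=\frac{n}{n-1}\frac{1}{g'}+\frac{n^2\alpha_n g''}{(n-1)(g')^3}+O\!\left(\frac{\delta^2g''}{(g')^4}+\frac{e^{-(g-\frac{n-1}{n}\gamma g')}}{g'}\right),$$ $$T(\gamma)=\Big(g-\tfrac{n-1}{n}\gamma g'\Big)+(n-1)\log\Big(\tfrac{n-1}{n}g'\Big)+\frac{\alpha_n(n-1)\gamma g''}{g'}+O\!\left(\frac{(\log g')^2}{g'}+\frac{(\log g')^{\beta+1}}{(g')^\beta}+e^{-(g-\frac{n-1}{n}\gamma g')}\right).$$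
   Context: Setting: Fix an integer $n\ge2$. Let $f\in C[0,\infty)\cap C^3(0,\infty)$ with $f(u)>0$ for $u>0$, and suppose $f(u)=e^{g(u)}$ for $u>0$, where $g(u)=au^q+\rho(u)$ with $a>0$, $1<q\le\frac{n}{n-1}$, $\rho\in C^3(0,\infty)$. Assume there exist $0<\alpha\le1$ and $\beta>0$ with $f(s)-f(0)=O(s^\beta)$ and $f'(s)=O(s^{\alpha-1})$ as $s\to0^+$. (H1) $\lim_{\gamma\to\infty}\rho^{(k)}(\gamma)/\gamma^{q-k}=0$ for $k=0,1,2,3$; (H2) there is $b\in\mathbb R$ with $\liminf_{\gamma\to\infty}\big(g(\gamma)-\frac{n-1}{n}\gamma g'(\gamma)\big)\ge b$. Shooting problem: for $\gamma>0$, $y(t)=y(t,\gamma)$ is the (increasing) solution of $-((y')^{n-1})'=f(y)e^{-t}$ with $y(t)\to\gamma$, $y'(t)\to0$ as $t\to\infty$, and $T(\gamma)=\inf\{t:\ y(s,\gamma)>0\ \forall s>t\}$ is its first zero. Notation: $g=g(\gamma)$, $g'=g'(\gamma)$, $g''=g''(\gamma)$, $\delta=\log g'(\gamma)$, $\alpha_n=1+\frac12+\dots+\frac1n$. $O(h(\gamma))$ denotes a quantity bounded in absolute value by $Ch(\gamma)$ with $C$ independent of $\gamma>\gamma_0$. *)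

(* Defs.v *)
From Stdlib Require Import Reals Lra Lia.
Open Scope R_scope.

Definition cont_on_nonneg (f : R -> R) : Prop :=
  forall x, 0 <= x -> forall eps, 0 < eps -> exists d, 0 < d /\
    forall z, 0 <= z -> Rabs (z - x) < d -> Rabs (f z - f x) < eps.

Definition cont_on_pos (h : R -> R) : Prop :=
  forall x, 0 < x -> continuity_pt h x.

Definition C3_pos (rho rho1 rho2 rho3 : R -> R) : Prop :=
  (forall u, 0 < u -> derivable_pt_lim rho u (rho1 u)) /\
  (forall u, 0 < u -> derivable_pt_lim rho1 u (rho2 u)) /\
  (forall u, 0 < u -> derivable_pt_lim rho2 u (rho3 u)) /\
  cont_on_pos rho3.

Definition gfun (a q : R) (rho : R -> R) (u : R) : R := a * Rpower u q + rho u.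
Definition g1fun (a q : R) (rho1 : R -> R) (u : R) : R :=
  a * q * Rpower u (q - 1) + rho1 u.
Definition g2fun (a q : R) (rho2 : R -> R) (u : R) : R :=
  a * q * (q - 1) * Rpower u (q - 2) + rho2 u.

Definition bigO_at0 (h : R -> R) (p : R) : Prop :=
  exists C d, 0 < d /\ forall s, 0 < s < d -> Rabs (h s) <= C * Rpower s p.

Definition lim_infty (h : R -> R) (l : R) : Prop :=
  forall eps, 0 < eps -> exists M, forall x, M < x -> Rabs (h x - l) < eps.

Definition liminf_ge (h : R -> R) (b : R) : Prop :=
  forall eps, 0 < eps -> exists M, forall x, M < x -> b - eps <= h x.

Definition harm (n : nat) : R := sum_f_R0 (fun k => / INR (S k)) (n - 1).

(* T = inf { t | y(s) > 0 for all s > t } *)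
Definition first_zero (y : R -> R) (T : R) : Prop :=
  (forall s, T < s -> 0 < y s) /\
  (forall t, t < T -> exists s, t < s /\ y s <= 0).

Definition shooting_solution (n : nat) (f : R -> R) (gam : R)
    (y yp : R -> R) (T : R) : Prop :=
  (forall t, T < t -> derivable_pt_lim y t (yp t)) /\
  (forall t, T < t ->
     derivable_pt_lim (fun s => (yp s) ^ (n - 1)) t (- (f (y t) * exp (- t)))) /\
  (forall s t, T <= s -> s < t -> y s < y t) /\
  y T = 0 /\
  (forall eps, 0 < eps -> exists d, 0 < d /\
     forall h, 0 < h < d -> Rabs ((y (T + h) - y T) / h - yp T) < eps) /\
  lim_infty y gam /\ lim_infty yp 0.

(* Main.v *)
Require Import Defs.
From Stdlib Require Import Reals Ranalysis5 Lra Lia.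
From Coquelicot Require Import Coquelicot.
Open Scope R_scope.

(** Write [n = m + 1], [G = g'(gam)], [eps = g''(gam) / G^2]. With [t = t0 - m x] and
    [y = gam - w / G], where [t0] is chosen so that the problem with [g] replaced by its tangent at
    [gam] has the explicit solution [w = n ln (1 + e^x)], the function [p = w'] solves
    [(p^m)' = F := m n^m e^(m x + h(w))], [h(w) = g(gam - w / G) - g(gam)].
    The defect [Q = F - m p^m + (m / n) p^n] of the first integral valid for [h(w) = - w]
    satisfies [Q' = (1 + h'(w)) p F], where [1 + h'(w) ~ eps w].
    The substitution [1 / p] linearises the first-order equation for [p], so [p] and [w] are
    close to the explicit profile as long as [w <= L := sqrt gam].  Hence
    [Q ~ eps m n^n H_n] where [w = L], and there [p ~ n + n^2 H_n eps] because
    [(m / n) p^m (p - n) = Q - F] with [F] exponentially small.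
    Beyond that point [p] increases, and convexity of [g] bounds [F] by [E e^(- c (X - x))]
    plus an exponentially small term, [X] being the value of [x] at the zero of [y]; integrating
    once controls [p] at [X], and integrating twice controls [X]. *)

(** * Functions vanishing at minus infinity, the logistic profile *)

(** The tangent approximation fails over most of the range: [h(w) + w] has size [eps w^2 / 2], and
    [eps W^2 = gam^2 g''] is large at the end value [W = gam G]. The comparison with the explicit
    profile therefore stops at [w = L], where [eps L^2 <= zeta / 4]; here [zeta], a multiple of
    [1 / G], is the relative accuracy aimed at. Beyond that point only an upper bound for [F] is
    used. Even for [w <= L] one comparison is not enough. It gives [p] up to a relative error
    [eps L], which is larger than the correction [n^2 H_n eps] to be found. But [Q] is itself of
    order [eps], so inserting these crude bounds into [Q'] determines [Q] with relative error
    [zeta], and the algebraic relation between [Q], [F] and [p] then gives [p] up to [eps zeta].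
    Since [y' = p / (m G)], this is the error [g'' / G^4]. The harmonic number is the value at [1]
    of a truncated series of [- ln (1 - s)], [s] being the logistic function. The quantity [E] is
    [exp (- (g - (n-1)/n gam g'))]: it measures the source where [y] is small and [f(y)] can only be
    bounded, not compared with the tangent exponential. *)

Definition vanishes_minf (f : R -> R) : Prop :=
  forall eps, 0 < eps -> exists X, forall x, x < X -> Rabs (f x) < eps.

Lemma vanishes_plus f g :
  vanishes_minf f -> vanishes_minf g -> vanishes_minf (fun x => f x + g x).
Proof.
intros Hf Hg eps Heps.
destruct (Hf (eps / 2)) as [X1 H1]; [lra|].
destruct (Hg (eps / 2)) as [X2 H2]; [lra|].
exists (Rmin X1 X2); intros x Hx.
specialize (H1 x (Rlt_le_trans _ _ _ Hx (Rmin_l _ _))).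
specialize (H2 x (Rlt_le_trans _ _ _ Hx (Rmin_r _ _))).
generalize (Rabs_triang (f x) (g x)); lra.
Qed.

Lemma vanishes_dominated C b f g :
  (forall x, x < b -> Rabs (f x) <= C * g x) -> vanishes_minf g -> vanishes_minf f.
Proof.
intros Hfg Hg eps Heps.
assert (HC : 0 < Rabs C + 1) by (generalize (Rabs_pos C); lra).
destruct (Hg (eps / (Rabs C + 1))) as [X HX]; [now apply Rdiv_lt_0_compat|].
exists (Rmin X b); intros x Hx.
specialize (HX x (Rlt_le_trans _ _ _ Hx (Rmin_l _ _))).
specialize (Hfg x (Rlt_le_trans _ _ _ Hx (Rmin_r _ _))).
apply Rle_lt_trans with (1 := Hfg).
apply Rle_lt_trans with (1 := Rle_abs _).
rewrite Rabs_mult.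
apply Rlt_div_r in HX; [|lra].
generalize (Rabs_pos (g x)) (Rabs_pos C); nra.
Qed.

Lemma vanishes_scal c f : vanishes_minf f -> vanishes_minf (fun x => c * f x).
Proof.
intros Hf.
assert (Ha : vanishes_minf (fun x => Rabs (f x))).
{ intros eps Heps; destruct (Hf eps Heps) as [X HX]; exists X; intros x Hx.
  now rewrite Rabs_Rabsolu; apply HX. }
apply vanishes_dominated with (2 := Ha) (C := Rabs c) (b := 0).
intros x _; rewrite Rabs_mult; lra.
Qed.

Lemma exp_le u v : u <= v -> exp u <= exp v.
Proof. intros [H|<-]; [left; now apply exp_increasing|lra]. Qed.

Lemma vanishes_0 : vanishes_minf (fun _ => 0).
Proof. intros e He; exists 0; intros _ _; now rewrite Rabs_R0. Qed.

Lemma vanishes_exp : vanishes_minf exp.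
Proof.
intros eps Heps; exists (ln eps); intros x Hx.
rewrite Rabs_pos_eq; [|left; apply exp_pos].
now rewrite <- (exp_ln eps) by easy; apply exp_increasing.
Qed.

Lemma increasing_of_derive (a b : R) (f f' : R -> R) :
  (forall x, a <= x <= b -> is_derive f x (f' x)) ->
  (forall x, a <= x <= b -> 0 <= f' x) -> a <= b -> f a <= f b.
Proof.
intros Hd Hp [Hab|<-]; [|lra].
destruct (MVT_cor2 f f' a b Hab) as [c [Hc1 Hc2]].
{ intros c Hc; apply is_derive_Reals, Hd, Hc. }
assert (0 <= f' c) by (apply Hp; lra).
assert (0 <= f' c * (b - a)) by (apply Rmult_le_pos; lra).
lra.
Qed.

(** This stands in for integration from minus infinity: each differential inequality of the inner
    region becomes the sign of a derivative together with decay at minus infinity, so that no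
    integral is formed. *)
Lemma nonneg_of_derive_minf (b : R) (f f' : R -> R) :
  (forall x, x <= b -> is_derive f x (f' x)) ->
  (forall x, x <= b -> 0 <= f' x) ->
  vanishes_minf f -> 0 <= f b.
Proof.
intros Hd Hp H0.
destruct (Rle_lt_dec 0 (f b)) as [H|H]; [easy|exfalso].
destruct (H0 (- f b)) as [X HX]; [lra|].
set (z := Rmin b X - 1).
assert (Hz1 : z < b) by (unfold z; generalize (Rmin_l b X); lra).
assert (Hz2 : z < X) by (unfold z; generalize (Rmin_r b X); lra).
specialize (HX z Hz2).
assert (f z <= f b).
{ apply increasing_of_derive with f'; [| |lra]; intros x Hx; [apply Hd|apply Hp]; lra. }
apply Rabs_def2 in HX; lra.
Qed.

(** [auto_derive] leaves derivatives in eta-expanded form; the statement keeps that form so that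
    [rewrite] finds it. *)
Lemma Derive_eta (f : R -> R) (x l : R) : is_derive f x l -> Derive (fun z => f z) x = l.
Proof. exact (is_derive_unique f x l). Qed.

(** Comparison functions are written in this one shape, padded with [0], [1 *] or [0 * 0] where
    fewer terms occur, so that a single lemma differentiates them. *)
Lemma is_derive_comb3 (F P Q : R -> R) (x F1 P1 Q1 b c : R) :
  is_derive F x F1 -> is_derive P x P1 -> is_derive Q x Q1 ->
  is_derive (fun z => F z + b * P z + c * Q z) x (F1 + b * P1 + c * Q1).
Proof.
intros DF DP DQ; auto_derive.
- repeat split; [now exists F1|now exists P1|now exists Q1].
- rewrite (Derive_eta _ _ _ DF), (Derive_eta _ _ _ DP), (Derive_eta _ _ _ DQ); ring.
Qed.

Lemma is_derive_eq (f : R -> R) (x l l' : R) : is_derive f x l -> l = l' -> is_derive f x l'.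
Proof. now intros H <-. Qed.

Lemma pow_le_inv (m : nat) (a b : R) : (1 <= m)%nat -> 0 <= b -> a ^ m <= b ^ m -> a <= b.
Proof.
intros Hm Hb H.
destruct (Rle_lt_dec a b) as [Hle|Hlt]; [easy|exfalso].
destruct m as [|m]; [lia|].
assert (b ^ S m < a ^ S m); [|lra].
simpl; apply Rle_lt_trans with (b * a ^ m).
- apply Rmult_le_compat_l; [easy|apply pow_incr; lra].
- apply Rmult_lt_compat_r; [apply pow_lt; lra|easy].
Qed.

(** The equation provides only the derivative of [p ^ m]. Positivity on a neighbourhood lets [p] be
    rewritten there as [exp (ln (p ^ m) / m)], to which the chain rule applies. *)
Lemma is_derive_of_pow (m : nat) (p : R -> R) (x X l : R) :
  (1 <= m)%nat -> x < X -> (forall z, z < X -> 0 < p z) ->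
  is_derive (fun z => p z ^ m) x l ->
  is_derive p x (l / (INR m * p x ^ pred m)).
Proof.
intros Hm Hx Hp Hd.
assert (HM : 0 < INR m) by (apply lt_0_INR; lia).
apply is_derive_ext_loc with (fun z => exp (ln (p z ^ m) / INR m)).
{ assert (HXx : 0 < X - x) by lra.
  exists (mkposreal _ HXx); intros z Hz.
  unfold ball in Hz; simpl in Hz; unfold AbsRing_ball, abs, minus, plus, opp in Hz; simpl in Hz.
  apply Rabs_def2 in Hz.
  rewrite ln_pow by (apply Hp; lra).
  replace (INR m * ln (p z) / INR m) with (ln (p z)) by (field; lra).
  apply exp_ln, Hp; lra. }
assert (Hpx := Hp x Hx).
assert (Hpm : 0 < p x ^ m) by now apply pow_lt.
assert (Hroot : forall P, is_derive P x l -> 0 < P x ->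
  is_derive (fun z => exp (ln (P z) / INR m)) x
    (l / P x / INR m * exp (ln (P x) / INR m))).
{ intros P HP HPx; auto_derive; [repeat split; [now exists l|easy]|].
  rewrite (Derive_eta _ _ _ HP).
  unfold Rdiv; field; lra. }
specialize (Hroot _ Hd Hpm).
replace (l / (INR m * p x ^ pred m)) with (l / p x ^ m / INR m * exp (ln (p x ^ m) / INR m));
  [exact Hroot|].
rewrite ln_pow by easy.
replace (INR m * ln (p x) / INR m) with (ln (p x)) by (field; lra).
rewrite exp_ln by easy.
clear Hroot Hd; generalize dependent (INR m); intros M HM.
destruct m as [|m]; [lia|].
rewrite <- pred_Sn; simpl pow.
assert (0 < p x ^ m) by now apply pow_lt.
field; lra.
Qed.

Lemma exp_INR_mult (k : nat) x : exp (INR k * x) = exp x ^ k.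
Proof.
induction k as [|k IH]; [now rewrite Rmult_0_l, exp_0|].
rewrite S_INR, Rmult_plus_distr_r, exp_plus, IH, Rmult_1_l; simpl; ring.
Qed.

Lemma vanishes_pow (f : R -> R) (b : R) (k : nat) : (1 <= k)%nat ->
  (forall x, x < b -> 0 < f x) -> vanishes_minf f -> vanishes_minf (fun x => f x ^ k).
Proof.
intros Hk Hp Hf.
destruct (Hf 1) as [X1 HX1]; [lra|].
apply vanishes_dominated with (2 := Hf) (C := 1) (b := Rmin X1 b).
intros x Hx.
specialize (HX1 x (Rlt_le_trans _ _ _ Hx (Rmin_l _ _))).
specialize (Hp x (Rlt_le_trans _ _ _ Hx (Rmin_r _ _))).
rewrite Rabs_pos_eq in HX1 by lra.
rewrite Rabs_pos_eq by now apply pow_le, Rlt_le.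
destruct k as [|k]; [lia|]; simpl.
assert (f x ^ k <= 1) by (rewrite <- (pow1 k); apply pow_incr; lra).
assert (0 < f x ^ k) by now apply pow_lt.
nra.
Qed.

Definition logistic (x : R) : R := exp x / (1 + exp x).

Lemma logistic_bounds x : 0 < logistic x < 1.
Proof.
unfold logistic; generalize (exp_pos x); intros H; split.
- apply Rdiv_lt_0_compat; lra.
- apply Rlt_div_l; lra.
Qed.

Lemma derive_logistic x : is_derive logistic x (logistic x * (1 - logistic x)).
Proof.
unfold logistic; generalize (exp_pos x); intros H.
auto_derive; [lra|]; field; lra.
Qed.

Lemma derive_softplus x : is_derive (fun x => ln (1 + exp x)) x (logistic x).
Proof.
unfold logistic; generalize (exp_pos x); intros H.
auto_derive; [lra|]; field; lra.
Qed.

Lemma softplus_bounds x : 0 < ln (1 + exp x) <= exp x.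
Proof.
generalize (exp_pos x); intros H; split.
- rewrite <- ln_1; apply ln_increasing; lra.
- rewrite <- (ln_exp (exp x)) at 2; apply ln_le; [lra|].
  apply exp_ineq1_le.
Qed.

Lemma vanishes_softplus : vanishes_minf (fun x => ln (1 + exp x)).
Proof.
apply vanishes_dominated with (2 := vanishes_exp) (C := 1) (b := 0).
intros x _; generalize (softplus_bounds x); intros H; rewrite Rabs_pos_eq; lra.
Qed.

(** Partial sum of [- ln (1 - s)] with [k + 1] terms, the upper index of [sum_f_R0] being included.
    Its derivative is a geometric sum and its value at [s = 1] is a harmonic number, which is how
    [harm] enters the expansion. *)
Definition log_series (k : nat) (s : R) : R :=
  sum_f_R0 (fun j => s ^ S j / INR (S j)) k.

Lemma derive_log_series k s : is_derive (log_series k) s (sum_f_R0 (fun j => s ^ j) k).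
Proof.
assert (Hterm : forall j, is_derive (fun s => s ^ S j / INR (S j)) s (s ^ j)).
{ intros j; assert (HS : 0 < INR (S j)) by (apply lt_0_INR; lia).
  apply is_derive_eq with (INR (S j) * 1 * s ^ pred (S j) / INR (S j)).
  - unfold Rdiv; apply (is_derive_ext (fun s => / INR (S j) * s ^ S j)); [intros; apply Rmult_comm|].
    apply is_derive_eq with (/ INR (S j) * (INR (S j) * 1 * s ^ pred (S j))); [|ring].
    apply @is_derive_scal, @is_derive_pow, @is_derive_id.
  - rewrite <- pred_Sn; field; lra. }
unfold log_series; induction k as [|k IH].
- exact (Hterm O).
- exact (@is_derive_plus _ _ _ _ _ _ _ IH (Hterm (S k))).
Qed.

Lemma log_series_bounds k s : 0 <= s <= 1 ->
  sum_f_R0 (fun j => / INR (S j)) k - INR (S k) * (1 - s) <= log_series k s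
    <= sum_f_R0 (fun j => / INR (S j)) k /\
  0 <= log_series k s <= INR (S k) * s.
Proof.
intros Hs.
assert (Hterm : forall j, / INR (S j) - (1 - s) <= s ^ S j / INR (S j) <= / INR (S j) /\
  0 <= s ^ S j / INR (S j) <= s).
{ intros j; assert (HS : 1 <= INR (S j)) by (apply (le_INR 1); lia).
  assert (Hi : 0 < / INR (S j) <= 1).
  { split; [apply Rinv_0_lt_compat; lra|rewrite <- Rinv_1; apply Rinv_le_contravar; lra]. }
  assert (Hp0 : 0 <= s ^ S j) by now apply pow_le.
  assert (Hp1 : s ^ j <= 1) by (rewrite <- (pow1 j); apply pow_incr; lra).
  assert (Hp1' : 0 <= s ^ j) by now apply pow_le.
  assert (Hp2 : s ^ S j <= s) by (simpl; nra).
  (* Bernoulli's inequality: after division by the exponent, each term of the series loses at most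
     [1 - s] against its value at [1]. *)
  assert (Hb : forall i, 1 - INR i * (1 - s) <= s ^ i).
  { induction i as [|i IH]; [simpl; lra|].
    rewrite S_INR; simpl.
    assert (s ^ i <= 1) by (rewrite <- (pow1 i); apply pow_incr; lra).
    nra. }
  specialize (Hb (S j)).
  assert (Hii : INR (S j) * / INR (S j) = 1) by (field; lra).
  unfold Rdiv; set (i := / INR (S j)) in *; clearbody i.
  repeat split; nra. }
unfold log_series; induction k as [|k IH].
- destruct (Hterm O) as [H1 H2]; simpl sum_f_R0; simpl INR in *; lra.
- destruct (Hterm (S k)) as [H1 H2]; rewrite !tech5.
  rewrite (S_INR (S k)) in H1, H2 |- *; lra.
Qed.

Lemma one_minus_pow (k : nat) (s : R) : 0 <= s <= 1 -> 0 <= 1 - s ^ k <= INR k * (1 - s).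
Proof.
intros Hs; induction k as [|k IH]; [simpl; lra|].
rewrite S_INR; simpl; assert (0 <= s ^ k) by now apply pow_le.
nra.
Qed.

Lemma pow_one_plus_le (k : nat) z : 0 <= z <= 1 / 2 -> (1 + z) ^ k <= 1 + 3 ^ k * z.
Proof.
intros Hz; induction k as [|k IH]; simpl; [lra|].
assert (1 <= 3 ^ k) by (apply pow_R1_Rle; lra).
assert (3 ^ k * z * z <= 3 ^ k * z * (1 / 2)) by (apply Rmult_le_compat_l; [nra|lra]).
nra.
Qed.

(* The defect of [h v = - v] perturbed to first order, in closed form: its derivative is
   [w0 p0 F0] for the profile [w0 = n ln (1 + e^x)], [p0 = w0'], [F0 = (p0 ^ m)']. *)
Definition profile_defect (m : nat) (x : R) : R :=
  INR m * INR (S m) ^ S m *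
  (log_series m (logistic x) - (1 - logistic x ^ S m) * ln (1 + exp x)).

(** Write [s] for [logistic x], so [s' = s (1 - s)]. The geometric sum turns the derivative of the
    series into [s (1 - s^n)], which cancels against [(1 - s^n)] times the derivative [s] of the
    softplus. Only the derivative of [s^n] times the softplus remains. *)
Lemma derive_profile_defect m x :
  is_derive (profile_defect m) x
   (INR m * INR (S m) ^ S m * INR (S m) * (logistic x ^ S m * (1 - logistic x) * ln (1 + exp x))).
Proof.
assert (Hs := logistic_bounds x).
assert (Dl : is_derive (fun x => log_series m (logistic x)) x
   (logistic x * (1 - logistic x) * sum_f_R0 (fun j => logistic x ^ j) m)).
{ apply @is_derive_comp; [apply derive_log_series|apply derive_logistic]. }
assert (Dp : is_derive (fun x => logistic x ^ S m) x
   (INR (S m) * (logistic x * (1 - logistic x)) * logistic x ^ pred (S m))).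
{ apply @is_derive_pow, derive_logistic. }
assert (Dw := derive_softplus x).
assert (Hgeo : (1 - logistic x) * sum_f_R0 (fun j => logistic x ^ j) m = 1 - logistic x ^ S m).
{ rewrite tech3 by lra; replace (m + 1)%nat with (S m) by lia; field; lra. }
unfold profile_defect.
assert (Hgen : forall A l P w (c l1 P1 w1 : R),
  is_derive l x l1 -> is_derive P x P1 -> is_derive w x w1 ->
  is_derive (fun x => A * (l x - (1 - P x) * w x)) x
    (A * (l1 + P1 * w x - (1 - P x) * w1))).
{ intros A l P w0 c l1 P1 w1 D1 D2 D3; auto_derive.
  - repeat split; eexists; eassumption.
  - rewrite (Derive_eta _ _ _ D1), (Derive_eta _ _ _ D2), (Derive_eta _ _ _ D3); ring. }
apply is_derive_eq with (1 := Hgen _ _ _ _ 0 _ _ _ Dl Dp Dw).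
rewrite (Rmult_assoc (logistic x) (1 - logistic x) (sum_f_R0 _ _)), Hgeo, <- pred_Sn.
simpl pow; ring.
Qed.

Lemma vanishes_profile_defect m : vanishes_minf (profile_defect m).
Proof.
set (K := INR m * INR (S m) ^ S m).
assert (HK : 0 <= K) by (apply Rmult_le_pos; [apply pos_INR|apply pow_le, pos_INR]).
apply vanishes_dominated with (2 := vanishes_exp) (C := K * (INR (S m) + 1)) (b := 0).
intros x _; assert (Hs := logistic_bounds x).
assert (Hse : logistic x <= exp x).
{ unfold logistic; generalize (exp_pos x); intros He; apply Rle_div_l; nra. }
destruct (log_series_bounds m (logistic x)) as [_ H1]; [lra|].
destruct (one_minus_pow (S m) (logistic x)) as [H2 _]; [lra|].
assert (H3 : 0 <= logistic x ^ S m) by (apply pow_le; lra).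
assert (Hw := softplus_bounds x).
assert (HN := pos_INR (S m)).
unfold profile_defect; fold K; rewrite Rabs_mult, (Rabs_pos_eq K) by easy.
rewrite Rmult_assoc; apply Rmult_le_compat_l; [easy|].
generalize dependent (INR (S m)); intros N; intros.
apply Rabs_le; nra.
Qed.

(** The factor [1 - logistic x = 1 / (1 + exp x)] beats the linear growth of the softplus, so the
    limit at plus infinity is [m n^n H_n]. The remainder is kept explicit because the bound is used
    at a finite point, the one where [w = L]. *)
Lemma profile_defect_bounds m x :
  INR m * INR (S m) ^ S m *
    (harm (S m) - (1 - logistic x) * (INR (S m) + INR (S m) * ln (1 + exp x)))
  <= profile_defect m x <= INR m * INR (S m) ^ S m * harm (S m).
Proof.
set (K := INR m * INR (S m) ^ S m).
assert (HK : 0 <= K) by (apply Rmult_le_pos; [apply pos_INR|apply pow_le, pos_INR]).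
assert (Hs := logistic_bounds x).
destruct (log_series_bounds m (logistic x)) as [H1 _]; [lra|].
destruct (one_minus_pow (S m) (logistic x)) as [H2 H3]; [lra|].
assert (Hw := softplus_bounds x).
unfold profile_defect, harm; fold K; replace (S m - 1)%nat with m by lia.
split; apply Rmult_le_compat_l; try easy; nra.
Qed.

Lemma harm_pos n : 0 < harm n.
Proof.
unfold harm; generalize (n - 1)%nat; intros k; induction k as [|k IH].
- simpl; lra.
- rewrite tech5; apply Rplus_lt_0_compat; [easy|apply Rinv_0_lt_compat, lt_0_INR; lia].
Qed.

(** * The rescaled problem *)

Definition source (m : nat) (h w : R -> R) (x : R) : R :=
  INR m * INR (S m) ^ m * exp (INR m * x + h (w x)).

(** Everything is stated strictly to the left of [X], because the shooting solution is
    differentiable only to the right of [T]. The end value is encoded by [bubble_end] as a left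
    limit of [w], and [h(0) = 0] by [bubble_h0] as a right limit. *)
Record bubble (m : nat) (h h1 : R -> R) (W X : R) (w p : R -> R) : Prop := {
  bubble_m : (1 <= m)%nat;
  bubble_dw : forall x, x < X -> is_derive w x (p x);
  bubble_dp : forall x, x < X -> is_derive (fun z => p z ^ m) x (source m h w x);
  bubble_pos : forall x, x < X -> 0 < p x;
  bubble_range : forall x, x < X -> 0 < w x < W;
  bubble_w0 : vanishes_minf w;
  bubble_p0 : vanishes_minf p;
  bubble_end : forall eps, 0 < eps -> exists d, 0 < d /\
    forall x, X - d < x < X -> W - w x < eps;
  bubble_dh : forall v, 0 < v < W -> is_derive h v (h1 v);
  bubble_h0 : forall eps, 0 < eps -> exists d, 0 < d /\
    forall v, 0 < v < d -> Rabs (h v) < eps }.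

Definition defect (m : nat) (h w p : R -> R) (x : R) : R :=
  source m h w x + - INR m * p x ^ m + INR m / INR (S m) * p x ^ S m.

Lemma source_pos m h w x : (1 <= m)%nat -> 0 < source m h w x.
Proof.
intros Hm; unfold source.
apply Rmult_lt_0_compat; [|apply exp_pos].
apply Rmult_lt_0_compat; [apply lt_0_INR; lia|apply pow_lt, lt_0_INR; lia].
Qed.

Lemma bubble_derive_p m h h1 W X w p (B : bubble m h h1 W X w p) x :
  x < X -> is_derive p x (source m h w x / (INR m * p x ^ pred m)).
Proof.
intros Hx.
apply is_derive_of_pow with X; [apply B|easy|apply B|now apply B].
Qed.

Lemma derive_source m h h1 W X w p (B : bubble m h h1 W X w p) x : x < X ->
  is_derive (source m h w) x (source m h w x * (INR m + h1 (w x) * p x)).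
Proof.
intros Hx.
assert (Dw : is_derive w x (p x)) by now apply B.
assert (Dh : is_derive h (w x) (h1 (w x))) by now apply B, B.
unfold source; generalize (INR m * INR (S m) ^ m); intros K; auto_derive.
- repeat split; [now exists (h1 (w x))|now exists (p x)].
- rewrite (Derive_eta _ _ _ Dw), (Derive_eta _ _ _ Dh); ring.
Qed.

Lemma derive_pow_S m h h1 W X w p (B : bubble m h h1 W X w p) x : x < X ->
  is_derive (fun z => p z ^ S m) x (INR (S m) / INR m * p x * source m h w x).
Proof.
intros Hx.
assert (Hpx := bubble_pos _ _ _ _ _ _ _ B x Hx).
assert (Hm := bubble_m _ _ _ _ _ _ _ B).
assert (HM : 0 < INR m) by (apply lt_0_INR; lia).
apply is_derive_eq with (INR (S m) * (source m h w x / (INR m * p x ^ pred m)) * p x ^ pred (S m)).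
- now apply @is_derive_pow, bubble_derive_p with (1 := B).
- generalize (INR (S m)); intros N.
  generalize dependent (INR m); intros M HM.
  rewrite <- pred_Sn.
  destruct m as [|k]; [lia|]; rewrite <- pred_Sn; simpl pow.
  assert (0 < p x ^ k) by now apply pow_lt.
  field; lra.
Qed.

(** The factor [e^(m x)] in the source contributes [m F], which [- m (p^m)'] removes, and
    [(m / n) (p^n)'] equals [p F]. What is left vanishes exactly when [h' = -1]. *)
Lemma derive_defect m h h1 W X w p (B : bubble m h h1 W X w p) x : x < X ->
  is_derive (defect m h w p) x ((1 + h1 (w x)) * p x * source m h w x).
Proof.
intros Hx.
assert (HDF : is_derive (fun z => source m h w z) x
   (source m h w x * (INR m + h1 (w x) * p x))) by now apply derive_source with (1 := B).
assert (HDP : is_derive (fun z => p z ^ m) x (source m h w x)) by now apply B.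
assert (Hpx := bubble_pos _ _ _ _ _ _ _ B x Hx).
assert (Hm := bubble_m _ _ _ _ _ _ _ B).
assert (HM : 0 < INR m) by (apply lt_0_INR; lia).
assert (HN : 0 < INR (S m)) by (apply lt_0_INR; lia).
assert (HDn := derive_pow_S _ _ _ _ _ _ _ B x Hx).
apply is_derive_eq with (1 := is_derive_comb3 _ _ _ _ _ _ _ (- INR m) (INR m / INR (S m)) HDF HDP HDn).
field; lra.
Qed.

Lemma le_div (a b c : R) : 0 < c -> a * c <= b -> a <= b / c.
Proof. intros Hc H; now apply Rle_div_r. Qed.

(* The equation [(m / n) p^m (p - n) = Q - F] normalised: [q = p], [a = p^m / n^m],
   [r = Q / (eps m n^n)], [phi = F / (m n^m)], [c = 1 - logistic x]; [k3] stands for [3 ^ m]. *)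
Lemma perturbation_arith (N M k3 H eps zeta c L a r phi q : R) :
  N = M + 1 -> 1 <= M -> 1 <= k3 -> 0 < H -> 0 < eps -> 0 <= zeta <= 1 / 2 -> 1 <= L ->
  N * zeta <= 1 -> 0 < c -> c * L <= 2 * (eps * zeta) -> c <= 2 * (eps * zeta) ->
  eps <= 1 / 8 -> c <= zeta / 4 -> M * c <= 1 / 4 ->
  1 - M * c <= a -> a <= 1 + k3 * zeta -> 0 <= r <= (1 + 9 * zeta) * H ->
  (1 - 2 * zeta) * (H - c * (N + L)) <= r ->
  (q - N) * a = N ^ 2 * eps * r - N * phi -> 0 <= phi <= 2 * c ->
  Rabs (q - (N + N ^ 2 * H * eps)) <=
    (N ^ 2 * (H * (9 + 3 * N + 6 * k3) + N + 1) + 8 * N) * (eps * zeta).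
Proof.
intros HN HM Hk3 HH He Hz HL HNz Hc0 HcL Hce Heps Hcz HMc Ha1 Ha2 Hr2 Hr1 Heq Hphi.
set (Z := eps * zeta) in *.
assert (Ha0 : 3 / 4 <= a) by lra.
set (d := q - N) in *.
assert (HN2e : 0 < N ^ 2 * eps) by (apply Rmult_lt_0_compat; [apply pow_lt|]; lra).
assert (Hup : d <= N ^ 2 * eps * H + N ^ 2 * H * (9 + 3 * N) * Z).
{ assert (Hda : d * a <= N ^ 2 * eps * ((1 + 9 * zeta) * H)).
  { rewrite Heq.
    assert (N ^ 2 * eps * r <= N ^ 2 * eps * ((1 + 9 * zeta) * H)) by (apply Rmult_le_compat_l; lra).
    assert (0 <= N * phi) by (apply Rmult_le_pos; lra).
    lra. }
  (* Division by [a >= 1 - M c] is absorbed by enlarging [9] to [9 + 3 N], since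
     [M c <= M zeta / 4]. *)
  assert (Hgoal : N ^ 2 * eps * ((1 + 9 * zeta) * H) <=
     (N ^ 2 * eps * H * (1 + (9 + 3 * N) * zeta)) * a).
  { replace (N ^ 2 * eps * ((1 + 9 * zeta) * H)) with (N ^ 2 * eps * H * (1 + 9 * zeta)) by ring.
    rewrite (Rmult_assoc (N ^ 2 * eps * H)).
    apply Rmult_le_compat_l; [apply Rmult_le_pos; lra|].
    assert (HNz0 : 0 <= N * zeta) by (apply Rmult_le_pos; lra).
    apply Rle_trans with ((1 + (9 + 3 * N) * zeta) * (1 - M * c));
      [|apply Rmult_le_compat_l; lra].
    assert (HMc0 : 0 <= M * c) by (apply Rmult_le_pos; lra).
    assert (M * zeta <= N * zeta) by (apply Rmult_le_compat_r; lra).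
    assert (M * c <= M * (zeta / 4)) by (apply Rmult_le_compat_l; lra).
    assert (N * zeta * (M * c) <= 1 * (M * c)) by (apply Rmult_le_compat_r; lra).
    assert (zeta * (M * c) <= 1 / 2 * (M * c)) by (apply Rmult_le_compat_r; lra).
    lra. }
  replace (N ^ 2 * eps * H + N ^ 2 * H * (9 + 3 * N) * Z)
    with (N ^ 2 * eps * H * (1 + (9 + 3 * N) * zeta)) by (unfold Z; ring).
  apply Rmult_le_reg_r with a; lra. }
assert (Hlow : N ^ 2 * eps * H - (N ^ 2 * (H * (2 + 6 * k3) + N + 1) + 8 * N) * Z <= d).
{ assert (Hr1' : H - 2 * zeta * H - c * (N + L) <= r).
  { apply Rle_trans with (2 := Hr1).
    assert (0 <= zeta * (c * (N + L))) by (repeat apply Rmult_le_pos; lra).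
    lra. }
  assert (Hk3z : 0 <= k3 * zeta) by (apply Rmult_le_pos; lra).
  assert (HcNL : c * (N + L) <= (N + 1) / 4 * zeta).
  { assert (Z <= 1 / 8 * zeta) by (apply Rmult_le_compat_r; lra).
    assert (c * N <= zeta / 4 * N) by (apply Rmult_le_compat_r; lra).
    lra. }
  assert (HHk3 : 0 <= H * (k3 * zeta)) by (apply Rmult_le_pos; lra).
  assert (HNz0 : 0 <= N * zeta) by (apply Rmult_le_pos; lra).
  assert (Hrk : H - (H * (2 + 6 * k3) + N + 1) * zeta <= r - k3 * zeta * r).
  (* [11 / 2] is [1 + 9 zeta] at the largest admissible value [zeta = 1 / 2]. *)
  { assert (k3 * zeta * r <= k3 * zeta * ((11 / 2) * H)).
    { apply Rmult_le_compat_l; [lra|]; apply Rle_trans with (1 := proj2 Hr2); apply Rmult_le_compat_r; lra. }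
    lra. }
  assert (Hmain : N ^ 2 * eps * (H - (H * (2 + 6 * k3) + N + 1) * zeta) - 4 * N * c <= d).
  { set (tgt := H - (H * (2 + 6 * k3) + N + 1) * zeta) in *.
    apply Rmult_le_reg_r with a; [lra|].
    rewrite Heq.
    (* The target can be negative, as [zeta] need not be small against [3 ^ m]; the upper bound on
       [a] applies only when it is positive. Then [(1 - k3 zeta) (1 + k3 zeta) <= 1] replaces a
       division by [a]. *)
    assert (Htr : tgt * a <= r).
    { destruct (Rle_lt_dec tgt 0) as [Hneg|Hpos].
      - apply Rle_trans with 0; [|lra]; rewrite <- (Rmult_0_l a); apply Rmult_le_compat_r; lra.
      - apply Rle_trans with (tgt * (1 + k3 * zeta)); [apply Rmult_le_compat_l; lra|].
        assert (tgt <= r - k3 * zeta * r) by lra.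
        apply Rle_trans with ((r - k3 * zeta * r) * (1 + k3 * zeta)); [apply Rmult_le_compat_r; lra|].
        assert (0 <= r * (k3 * zeta) ^ 2) by (apply Rmult_le_pos; [lra|apply pow2_ge_0]).
        lra. }
    assert (N ^ 2 * eps * (tgt * a) <= N ^ 2 * eps * r) by (apply Rmult_le_compat_l; lra).
    assert (N * c * (3 / 4) <= N * c * a).
    { apply Rmult_le_compat_l; [apply Rmult_le_pos|]; lra. }
    assert (N * phi <= N * (2 * c)) by (apply Rmult_le_compat_l; lra).
    assert (0 <= N * c) by (apply Rmult_le_pos; lra).
    lra. }
  assert (N * c <= N * (2 * Z)) by (apply Rmult_le_compat_l; lra).
  unfold Z in *; lra. }
apply Rabs_le; unfold Z in *; split.
+ assert (0 <= N ^ 2 * (H * (7 + 3 * N)) * (eps * zeta)).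
  { repeat apply Rmult_le_pos; try lra; apply pow2_ge_0. }
  unfold d in *; lra.
+ assert (0 <= (N ^ 2 * (H * (6 * k3) + N + 1) + 8 * N) * (eps * zeta)).
  { apply Rmult_le_pos; [|apply Rmult_le_pos; lra].
    assert (0 <= N ^ 2 * (H * (6 * k3) + N + 1)) by (apply Rmult_le_pos; [apply pow2_ge_0|]; assert (0 <= H * k3) by (apply Rmult_le_pos; lra); lra).
    lra. }
  unfold d in *; lra.
Qed.

(** * The inner region *)

(** [zeta] bounds the relative error of the slope [1 + h' ~ eps v]. Through [ne_small] it also
    bounds the accumulated deviation: [h(v) + v <= eps v^2 <= zeta / 4] up to [v = L]. One parameter
    thus measures all relative errors of the inner region. *)
Record near_exponential (h1 : R -> R) (eps zeta L : R) : Prop := {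
  ne_eps : 0 < eps;
  ne_zeta : 0 <= zeta <= 1 / 2;
  ne_L : 1 <= L;
  ne_small : 4 * eps * L ^ 2 <= zeta;
  ne_slope : forall v, 0 < v <= L ->
    eps * v * (1 - zeta) <= 1 + h1 v <= eps * v * (1 + zeta) }.

Lemma nonneg_of_derive_zero (b : R) (f f' : R -> R) : 0 < b ->
  (forall x, 0 < x <= b -> is_derive f x (f' x)) ->
  (forall x, 0 < x <= b -> 0 <= f' x) ->
  (forall eps, 0 < eps -> exists d, 0 < d /\ forall x, 0 < x < d -> Rabs (f x) < eps) ->
  0 <= f b.
Proof.
intros Hb Hd Hp H0.
destruct (Rle_lt_dec 0 (f b)) as [H|H]; [easy|exfalso].
destruct (H0 (- f b)) as [d [Hd0 Hd1]]; [lra|].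
set (z := Rmin b d / 2).
assert (Hz0 : 0 < Rmin b d) by now apply Rmin_glb_lt.
assert (Hz1 : z < b) by (unfold z; generalize (Rmin_l b d); lra).
assert (Hz2 : 0 < z < d) by (unfold z; generalize (Rmin_r b d); lra).
specialize (Hd1 z Hz2).
assert (f z <= f b).
{ apply increasing_of_derive with f'; [| |lra]; intros x Hx; [apply Hd|apply Hp]; lra. }
apply Rabs_def2 in Hd1; lra.
Qed.

(** As [1 + zeta <= 2], the slope [1 + h'] lies between [0] and [2 eps v]; comparing from [0], where
    [h] has limit [0], gives both bounds. *)
Lemma near_exponential_bounds h h1 eps zeta L W :
  near_exponential h1 eps zeta L -> L < W ->
  (forall v, 0 < v < W -> is_derive h v (h1 v)) ->
  (forall e, 0 < e -> exists d, 0 < d /\ forall v, 0 < v < d -> Rabs (h v) < e) ->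
  forall v, 0 < v <= L -> - v <= h v <= - v + eps * v ^ 2.
Proof.
intros [He Hz HL Hs Hsl] HLW Hd H0 v Hv.
assert (Hsmall : forall c e, 0 <= c -> 0 < e -> exists d, 0 < d /\
  forall v, 0 < v < d -> Rabs (h v) + v + c * v ^ 2 < e).
{ intros c e Hc He'; destruct (H0 (e / 3)) as [d [Hd0 Hd1]]; [lra|].
  assert (Hc1 : 0 < e / 3 / (c + 1)) by (apply Rdiv_lt_0_compat; lra).
  exists (Rmin (Rmin d 1) (Rmin (e / 3) (e / 3 / (c + 1)))); split.
  - repeat apply Rmin_glb_lt; lra.
  - intros u [Hu1 Hu2].
    assert (Hu3 := Rlt_le_trans _ _ _ Hu2 (Rmin_l _ _)).
    assert (Hu4 := Rlt_le_trans _ _ _ Hu2 (Rmin_r _ _)).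
    assert (u < d) by (apply Rlt_le_trans with (1 := Hu3), Rmin_l).
    assert (u < 1) by (apply Rlt_le_trans with (1 := Hu3), Rmin_r).
    assert (u < e / 3) by (apply Rlt_le_trans with (1 := Hu4), Rmin_l).
    assert (Hu5 : u < e / 3 / (c + 1)) by (apply Rlt_le_trans with (1 := Hu4), Rmin_r).
    apply Rlt_div_r in Hu5; [|lra].
    assert (Rabs (h u) < e / 3) by (apply Hd1; lra).
    nra. }
split.
- enough (0 <= h v + 1 * v + 0 * v) by lra.
  apply (nonneg_of_derive_zero v (fun v => h v + 1 * v + 0 * v) (fun v => h1 v + 1 * 1 + 0 * 1)); [lra| | |].
  + intros u Hu; apply (is_derive_comb3 h (fun v => v) (fun v => v));
      [apply Hd; lra|apply @is_derive_id|apply @is_derive_id].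
  + intros u Hu; specialize (Hsl u ltac:(lra)).
    assert (0 <= eps * u * (1 - zeta)) by (apply Rmult_le_pos; [apply Rmult_le_pos|]; lra).
    lra.
  + intros e He'; destruct (Hsmall 0 e (Rle_refl 0) He') as [d [Hd0 Hd1]].
    exists d; split; [easy|]; intros u Hu; specialize (Hd1 u Hu).
    apply Rle_lt_trans with (2 := Hd1).
    replace (h u + 1 * u + 0 * u) with (h u + u) by ring.
    generalize (Rabs_triang (h u) u); rewrite (Rabs_pos_eq u) by lra; lra.
- enough (0 <= eps * v ^ 2 + (-1) * h v + (-1) * v) by lra.
  apply (nonneg_of_derive_zero v (fun v => eps * v ^ 2 + (-1) * h v + (-1) * v) (fun v => eps * (2 * v) + (-1) * h1 v + (-1) * 1)); [lra| | |].
  + intros u Hu; apply (is_derive_comb3 (fun v => eps * v ^ 2) h (fun v => v));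
      [auto_derive; [easy|ring]|apply Hd; lra|apply @is_derive_id].
  + intros u Hu; specialize (Hsl u ltac:(lra)).
    assert (0 < eps * u) by (apply Rmult_lt_0_compat; lra).
    nra.
  + intros e He'; destruct (Hsmall eps e (Rlt_le _ _ He) He') as [d [Hd0 Hd1]].
    exists d; split; [easy|]; intros u Hu; specialize (Hd1 u Hu).
    apply Rle_lt_trans with (2 := Hd1).
    assert (0 <= eps * u ^ 2) by (apply Rmult_le_pos; [lra|apply pow2_ge_0]).
    cbv beta; apply Rabs_le; generalize (Rle_abs (h u)) (Rle_abs (- h u)); rewrite Rabs_Ropp; lra.
Qed.

Section Inner.
Context (m : nat) (h h1 : R -> R) (W X : R) (w p : R -> R)
  (B : bubble m h h1 W X w p) (eps zeta L : R) (E : near_exponential h1 eps zeta L)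
  (HLW : L < W).

Let Hm := bubble_m _ _ _ _ _ _ _ B.
Let ppos := bubble_pos _ _ _ _ _ _ _ B.

Let HM : 1 <= INR m.
Proof. apply (le_INR 1), Hm. Qed.

Let HN : INR (S m) = INR m + 1.
Proof. apply S_INR. Qed.

Lemma bubble_w_increasing x z : x <= z -> z < X -> w x <= w z.
Proof.
intros Hxz Hz; apply increasing_of_derive with p; [| |easy]; intros u Hu.
- apply B; lra.
- left; apply ppos; lra.
Qed.

Lemma inner_h x : x < X -> w x <= L -> - w x <= h (w x) <= - w x + eps * w x ^ 2.
Proof.
intros Hx HwL; apply near_exponential_bounds with h1 zeta L W; [easy|easy|apply B|apply B|].
split; [now apply B|easy].
Qed.

Lemma inner_epsL : 4 * eps * L <= zeta.
Proof.
destruct E as [He Hz HL Hs _].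
assert (eps * L <= eps * L ^ 2) by (apply Rmult_le_compat_l; [lra|simpl; nra]).
lra.
Qed.

Lemma inner_h_nonpos x : x < X -> w x <= L -> h (w x) <= 0.
Proof.
intros Hx HwL; destruct (inner_h x Hx HwL) as [_ H].
assert (H1 := inner_epsL).
destruct E as [He Hz HL Hs _]; destruct (bubble_range _ _ _ _ _ _ _ B x Hx) as [Hw _].
assert (eps * w x <= 1 / 8) by nra.
nra.
Qed.

Lemma inner_below : exists b, b < X /\ forall x, x <= b -> w x <= L.
Proof.
destruct (bubble_w0 _ _ _ _ _ _ _ B L) as [X0 HX0]; [destruct E; lra|].
exists (Rmin X X0 - 1); split; [generalize (Rmin_l X X0); lra|].
intros x Hx; assert (x < X0) by (generalize (Rmin_r X X0); lra).
specialize (HX0 x H); apply Rabs_def2 in HX0; lra.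
Qed.

Lemma vanishes_exp_INR : vanishes_minf (fun x => exp (INR m * x)).
Proof.
intros e He; destruct (vanishes_pow exp 0 m Hm (fun x _ => exp_pos x) vanishes_exp e He) as [X0 H0].
exists X0; intros x Hx; rewrite exp_INR_mult; now apply H0.
Qed.

Lemma source_le x : x < X -> w x <= L -> 
  source m h w x <= INR m * INR (S m) ^ m * exp (INR m * x).
Proof.
intros Hx HwL; unfold source; apply Rmult_le_compat_l.
- apply Rmult_le_pos; [lra|apply pow_le; lra].
- generalize (inner_h_nonpos x Hx HwL); intros H.
  destruct (Rle_lt_or_eq_dec (h (w x)) 0 H) as [H1|H1].
  + left; apply exp_increasing; lra.
  + right; f_equal; lra.
Qed.

Lemma vanishes_source : vanishes_minf (source m h w).
Proof.
destruct inner_below as [b [HbX Hb]].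
apply vanishes_dominated with (2 := vanishes_exp_INR) (C := INR m * INR (S m) ^ m) (b := b).
intros x Hx; rewrite Rabs_pos_eq by now apply Rlt_le, source_pos.
apply source_le; [lra|apply Hb; lra].
Qed.

Lemma vanishes_defect : vanishes_minf (defect m h w p).
Proof.
unfold defect; apply vanishes_plus; [apply vanishes_plus|].
- apply vanishes_source.
- apply vanishes_scal, vanishes_pow with X; [easy|apply B|apply B].
- apply vanishes_scal, vanishes_pow with X; [lia|apply B|apply B].
Qed.

Lemma slope_bounds x : x < X -> w x <= L -> 0 <= 1 + h1 (w x) <= 2 * eps * L.
Proof.
intros Hx HwL.
destruct (bubble_range _ _ _ _ _ _ _ B x Hx) as [Hw _].
destruct E as [He Hz HL Hs Hsl]; specialize (Hsl (w x) (conj Hw HwL)).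
assert (0 < eps * w x <= eps * L).
{ split; [apply Rmult_lt_0_compat; lra|apply Rmult_le_compat_l; lra]. }
nra.
Qed.

(** First, crude pass. Since [p F] is [m / n] times the derivative of [p^n], the bound [2 eps L] on
    [1 + h'] integrates exactly, before anything is known about the size of [p]. *)
Lemma defect_bounds x : x < X -> w x <= L ->
  0 <= defect m h w p x <= 2 * eps * L * (INR m / INR (S m)) * p x ^ S m.
Proof.
intros Hx HwL.
assert (Hlow : forall z, z <= x -> z < X /\ w z <= L).
{ intros z Hz; split; [lra|]; apply Rle_trans with (2 := HwL).
  now apply bubble_w_increasing. }
assert (HpF : forall z, z <= x -> 0 <= p z * source m h w z).
{ intros z Hz; apply Rmult_le_pos; left; [apply ppos, Hlow, Hz|now apply source_pos]. }
split.
- apply nonneg_of_derive_minf with (3 := vanishes_defect)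
    (f' := fun x => (1 + h1 (w x)) * p x * source m h w x).
  + intros z Hz; apply derive_defect with (1 := B); now apply Hlow.
  + intros z Hz; rewrite Rmult_assoc; apply Rmult_le_pos; [|now apply HpF].
    apply slope_bounds; now apply Hlow.
- assert (Hd : 0 <= 0 + (2 * eps * L * (INR m / INR (S m))) * p x ^ S m + -1 * defect m h w p x);
    [|lra].
  apply (nonneg_of_derive_minf x
    (fun x => 0 + (2 * eps * L * (INR m / INR (S m))) * p x ^ S m + -1 * defect m h w p x)
    (fun x => 0 + (2 * eps * L * (INR m / INR (S m))) * (INR (S m) / INR m * p x * source m h w x)
        + -1 * ((1 + h1 (w x)) * p x * source m h w x))).
  + intros z Hz; apply (is_derive_comb3 (fun _ => 0) (fun x => p x ^ S m) (defect m h w p)).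
    * apply @is_derive_const.
    * apply (derive_pow_S _ _ _ _ _ _ _ B); now apply Hlow.
    * apply derive_defect with (1 := B); now apply Hlow.
  + intros z Hz.
    replace (0 + 2 * eps * L * (INR m / INR (S m)) * (INR (S m) / INR m * p z * source m h w z) +
      -1 * ((1 + h1 (w z)) * p z * source m h w z))
      with ((2 * eps * L - (1 + h1 (w z))) * (p z * source m h w z)) by (field; lra).
    apply Rmult_le_pos; [|now apply HpF].
    generalize (slope_bounds z (proj1 (Hlow z Hz)) (proj2 (Hlow z Hz))); lra.
  + apply vanishes_plus; [apply vanishes_plus|].
    * apply vanishes_0.
    * apply vanishes_scal, vanishes_pow with X; [lia|apply B|apply B].
    * apply vanishes_scal, vanishes_defect.
Qed.

(** With [e^h] between [e^(-mu)] and [1], the equation for [p^m] is compared with multiples of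
    [n^m e^(m x)]. Taking roots would give [e^(-mu / m)] below; the weaker [e^(-mu)] suffices
    because [mu] is arbitrarily small near minus infinity. *)
Lemma pow_asymptotics mu x : 0 <= mu -> x < X ->
  (forall z, z <= x -> - mu <= h (w z) <= 0) ->
  exp (- mu) * INR (S m) * exp x <= p x <= INR (S m) * exp x.
Proof.
intros Hmu Hx Hh.
set (K := INR (S m) ^ m).
assert (HK : 0 < K) by (apply pow_lt; lra).
assert (HP0 : vanishes_minf (fun z => p z ^ m)) by (apply vanishes_pow with X; [easy|apply B|apply B]).
assert (Dexp : forall z, is_derive (fun z => exp (INR m * z)) z (INR m * exp (INR m * z))).
{ intros z; auto_derive; [easy|ring]. }
assert (Hs : forall z, source m h w z = INR m * K * exp (INR m * z) * exp (h (w z))).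
{ intros z; unfold source, K; rewrite exp_plus; ring. }
assert (Hpos : forall z, 0 <= INR m * K * exp (INR m * z)).
{ intros z; apply Rmult_le_pos; [apply Rmult_le_pos; lra|left; apply exp_pos]. }
split.
- assert (HP : 0 <= 0 + 1 * p x ^ m + - (exp (- mu) * K) * exp (INR m * x)).
  { apply (nonneg_of_derive_minf x
     (fun z => 0 + 1 * p z ^ m + - (exp (- mu) * K) * exp (INR m * z))
     (fun z => 0 + 1 * source m h w z + - (exp (- mu) * K) * (INR m * exp (INR m * z)))).
    - intros z Hz; apply (is_derive_comb3 (fun _ => 0) (fun z => p z ^ m) (fun z => exp (INR m * z)));
       [apply @is_derive_const|apply B; lra|apply Dexp].
    - intros z Hz; rewrite Hs.
      assert (exp (- mu) <= exp (h (w z))) by (apply exp_le, Hh, Hz).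
      generalize (Hpos z); nra.
    - apply vanishes_plus; [apply vanishes_plus|].
      + apply vanishes_0.
      + now apply vanishes_scal.
      + apply vanishes_scal, vanishes_exp_INR. }
  apply pow_le_inv with m; [easy|now left; apply ppos|].
  rewrite !Rpow_mult_distr, <- (exp_INR_mult m x); fold K.
  apply Rle_trans with (exp (- mu) * K * exp (INR m * x)); [|lra].
  apply Rmult_le_compat_r; [left; apply exp_pos|].
  apply Rmult_le_compat_r; [lra|].
  rewrite <- exp_INR_mult; apply exp_le; nra.
- assert (HP : 0 <= 0 + (-1) * p x ^ m + K * exp (INR m * x)).
  { apply (nonneg_of_derive_minf x
     (fun z => 0 + (-1) * p z ^ m + K * exp (INR m * z))
     (fun z => 0 + (-1) * source m h w z + K * (INR m * exp (INR m * z)))).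
    - intros z Hz; apply (is_derive_comb3 (fun _ => 0) (fun z => p z ^ m) (fun z => exp (INR m * z)));
       [apply @is_derive_const|apply B; lra|apply Dexp].
    - intros z Hz; rewrite Hs.
      assert (exp (h (w z)) <= exp 0) by (apply exp_le, Hh, Hz); rewrite exp_0 in *.
      generalize (Hpos z); nra.
    - apply vanishes_plus; [apply vanishes_plus|].
      + apply vanishes_0.
      + now apply vanishes_scal.
      + apply vanishes_scal, vanishes_exp_INR. }
  apply pow_le_inv with m; [easy|apply Rmult_le_pos; [lra|left; apply exp_pos]|].
  rewrite !Rpow_mult_distr, <- (exp_INR_mult m x); fold K; lra.
Qed.

(** The initial condition for the linear equation satisfied by [1 / p]. It says that [p ~ n e^x] at
    minus infinity, which singles out the explicit profile among its translates. *)
Lemma vanishes_recip : vanishes_minf (fun x => exp x / p x - (1 + exp x) / INR (S m)).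
Proof.
intros e He.
set (mu := ln (1 + e / 2)).
assert (Hmu : 0 < mu) by (rewrite <- ln_1; apply ln_increasing; lra).
destruct (bubble_h0 _ _ _ _ _ _ _ B mu Hmu) as [d [Hd0 Hd]].
destruct (bubble_w0 _ _ _ _ _ _ _ B d Hd0) as [X1 HX1].
destruct (vanishes_exp (e / 2)) as [X2 HX2]; [lra|].
destruct inner_below as [b [HbX Hb]].
exists (Rmin (Rmin X1 X2) b); intros x Hx.
assert (Hx' := Rlt_le_trans _ _ _ Hx (Rmin_l _ _)).
assert (Hxb := Rlt_le_trans _ _ _ Hx (Rmin_r _ _)).
assert (Hx1 := Rlt_le_trans _ _ _ Hx' (Rmin_l _ _)).
assert (Hx2 := Rlt_le_trans _ _ _ Hx' (Rmin_r _ _)).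
specialize (HX2 x Hx2); rewrite Rabs_pos_eq in HX2 by (left; apply exp_pos).
assert (Hex := exp_pos x).
destruct (pow_asymptotics mu x) as [Hl Hu]; [lra|lra| |].
{ intros z Hz.
  assert (Hw : 0 < w z < W) by (apply B; lra).
  assert (Hh : Rabs (h (w z)) < mu).
  { apply Hd; specialize (HX1 z ltac:(lra)); rewrite Rabs_pos_eq in HX1; lra. }
  apply Rabs_def2 in Hh; split; [lra|].
  apply inner_h_nonpos; [lra|apply Hb; lra]. }
assert (Hp : 0 < p x) by (apply ppos; lra).
assert (HN1 : 2 <= INR (S m)) by lra.
assert (H1 : 1 / INR (S m) <= exp x / p x).
{ apply Rmult_le_reg_r with (INR (S m) * p x); [nra|].
  replace (1 / INR (S m) * (INR (S m) * p x)) with (p x) by (field; lra).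
  replace (exp x / p x * (INR (S m) * p x)) with (INR (S m) * exp x) by (field; lra).
  easy. }
assert (H2 : exp x / p x <= (1 + e / 2) / INR (S m)).
{ apply Rmult_le_reg_r with (INR (S m) * p x); [nra|].
  replace ((1 + e / 2) / INR (S m) * (INR (S m) * p x)) with ((1 + e / 2) * p x) by (field; lra).
  replace (exp x / p x * (INR (S m) * p x)) with (INR (S m) * exp x) by (field; lra).
  rewrite exp_Ropp in Hl; unfold mu in Hl; rewrite exp_ln in Hl by lra.
  rewrite Rmult_assoc in Hl.
  apply (Rmult_le_compat_l (1 + e / 2)) in Hl; [|lra].
  rewrite <- Rmult_assoc, Rinv_r, Rmult_1_l in Hl; lra. }
assert (H3 : 0 < / INR (S m) <= 1).
{ split; [apply Rinv_0_lt_compat; lra|rewrite <- Rinv_1; apply Rinv_le_contravar; lra]. }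
unfold Rdiv in *; apply Rabs_def1; nra.
Qed.

(** Eliminating [F] through [Q] gives [p' = p - p^2 / n + Q / (m p^(m-1))], which is linear in
    [1 / p] up to the defect: [(e^x / p)' = e^x / n - e^x Q / (m p^n)]. The bound on [Q] is
    proportional to [p^n], so the last quotient is at most [2 eps L / n] times [e^x], uniformly. *)
Lemma recip_bounds x : x < X -> w x <= L ->
  - (2 * eps * L / INR (S m)) * exp x <= exp x / p x - (1 + exp x) / INR (S m) <= 0.
Proof.
intros Hx HwL.
assert (Hlow : forall z, z <= x -> z < X /\ w z <= L).
{ intros z Hz; split; [lra|]; apply Rle_trans with (2 := HwL).
  now apply bubble_w_increasing. }
assert (Dr : forall z, z <= x -> is_derive (fun x => exp x / p x - (1 + exp x) / INR (S m)) z
   (- exp z * (defect m h w p z / (INR m * p z ^ S m)))).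
{ intros z Hz.
  assert (Dp := bubble_derive_p _ _ _ _ _ _ _ B z (proj1 (Hlow z Hz))).
  assert (Hp := ppos z (proj1 (Hlow z Hz))).
  unfold defect.
  generalize dependent (source m h w z); intros F Dp.
  generalize dependent (INR (S m)); intros N HN'; auto_derive.
  - repeat split; [now eexists; apply Dp|lra].
  - rewrite (Derive_eta _ _ _ Dp).
    generalize dependent (INR m); intros M ? ? ?.
    destruct m as [|k]; [lia|]; rewrite <- pred_Sn; simpl pow.
    assert (0 < p z ^ k) by now apply pow_lt.
    intros HN1; field; lra. }
assert (Hdef : forall z, z <= x -> 0 <= defect m h w p z / (INR m * p z ^ S m) <= 2 * eps * L / INR (S m)).
{ intros z Hz; destruct (Hlow z Hz) as [H1 H2].
  destruct (defect_bounds z H1 H2) as [H3 H4].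
  assert (Hp : 0 < p z ^ S m) by now apply pow_lt, ppos.
  split.
  - apply Rle_div_r; [nra|lra].
  - apply Rle_div_l; [nra|].
    apply Rle_trans with (1 := H4); right; field; lra. }
split.
- assert (Hd : 0 <= 0 + 1 * (exp x / p x - (1 + exp x) / INR (S m)) + (2 * eps * L / INR (S m)) * exp x);
    [|lra].
  apply (nonneg_of_derive_minf x
    (fun x => 0 + 1 * (exp x / p x - (1 + exp x) / INR (S m)) + (2 * eps * L / INR (S m)) * exp x)
    (fun z => 0 + 1 * (- exp z * (defect m h w p z / (INR m * p z ^ S m)))
       + (2 * eps * L / INR (S m)) * exp z)).
  + intros z Hz; apply (is_derive_comb3 (fun _ => 0)); [apply @is_derive_const|now apply Dr|].
    apply is_derive_Reals, derivable_pt_lim_exp.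
  + intros z Hz; specialize (Hdef z Hz); generalize (exp_pos z); nra.
  + apply vanishes_plus; [apply vanishes_plus|].
    * apply vanishes_0.
    * apply vanishes_scal, vanishes_recip.
    * apply vanishes_scal, vanishes_exp.
- assert (Hd : 0 <= 0 + (-1) * (exp x / p x - (1 + exp x) / INR (S m)) + 0 * exp x);
    [|lra].
  apply (nonneg_of_derive_minf x
    (fun x => 0 + (-1) * (exp x / p x - (1 + exp x) / INR (S m)) + 0 * exp x)
    (fun z => 0 + (-1) * (- exp z * (defect m h w p z / (INR m * p z ^ S m))) + 0 * exp z)).
  + intros z Hz; apply (is_derive_comb3 (fun _ => 0)); [apply @is_derive_const|now apply Dr|].
    apply is_derive_Reals, derivable_pt_lim_exp.
  + intros z Hz; specialize (Hdef z Hz); generalize (exp_pos z); nra.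
  + apply vanishes_plus; [apply vanishes_plus|].
    * apply vanishes_0.
    * apply vanishes_scal, vanishes_recip.
    * apply vanishes_scal, vanishes_exp.
Qed.

(** Inversion of the bounds on [e^x / p]. The loss [2 eps L] becomes [4 eps L] because
    [1 <= (1 - 2 k) (1 + 4 k)] for [k = eps L <= 1 / 8]. *)
Lemma p_bounds x : x < X -> w x <= L ->
  INR (S m) * logistic x <= p x <= INR (S m) * logistic x * (1 + 4 * eps * L).
Proof.
intros Hx HwL.
destruct (recip_bounds x Hx HwL) as [H1 H2].
assert (Hp := ppos x Hx); assert (Hex := exp_pos x).
assert (HeL : 0 < eps * L) by (destruct E; apply Rmult_lt_0_compat; lra).
assert (HeL' := inner_epsL).
assert (Hz := ne_zeta _ _ _ _ E).
assert (Hq : exp x / p x * p x = exp x) by (field; lra).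
set (q := exp x / p x) in *.
unfold logistic; generalize dependent (INR (S m)); intros N HN' H1 H2.
assert (HN0 : 0 < N) by lra.
assert (H3 : N * q <= 1 + exp x).
{ apply (Rmult_le_compat_l N) in H2; [|lra]; field_simplify in H2; lra. }
assert (H4 : 1 + exp x - 2 * eps * L * exp x <= N * q).
{ apply (Rmult_le_compat_l N) in H1; [|lra]; field_simplify in H1; lra. }
split.
- apply Rmult_le_reg_r with (1 + exp x); [lra|].
  replace (N * (exp x / (1 + exp x)) * (1 + exp x)) with (N * exp x) by (field; lra).
  rewrite <- Hq; nra.
- apply Rmult_le_reg_r with (1 + exp x); [lra|].
  replace (N * (exp x / (1 + exp x)) * (1 + 4 * eps * L) * (1 + exp x))
    with (N * exp x * (1 + 4 * eps * L)) by (field; lra).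
  rewrite <- Hq.
  replace (N * (q * p x) * (1 + 4 * eps * L)) with (p x * ((N * q) * (1 + 4 * eps * L))) by ring.
  apply Rmult_le_compat_l; [lra|].
  apply Rle_trans with ((1 + exp x - 2 * eps * L * exp x) * (1 + 4 * eps * L)); [|nra].
  replace (2 * eps * L) with (2 * (eps * L)) by ring.
  replace (4 * eps * L) with (4 * (eps * L)) in * by ring.
  set (k := eps * L) in *; clearbody k.
  assert (k <= 1 / 8) by lra.
  assert (0 <= k * exp x) by (apply Rmult_le_pos; lra).
  nra.
Qed.

Lemma w_bounds x : x < X -> w x <= L ->
  INR (S m) * ln (1 + exp x) <= w x <= INR (S m) * ln (1 + exp x) * (1 + 4 * eps * L).
Proof.
intros Hx HwL.
assert (Hlow : forall z, z <= x -> z < X /\ w z <= L).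
{ intros z Hz; split; [lra|]; apply Rle_trans with (2 := HwL).
  now apply bubble_w_increasing. }
assert (Hcmp : forall a b, 
  (forall z, z <= x -> 0 <= a * p z + b * logistic z) -> 0 <= 0 + a * w x + b * ln (1 + exp x)).
{ intros a b Hab.
  apply (nonneg_of_derive_minf x
    (fun x => 0 + a * w x + b * ln (1 + exp x))
    (fun z => 0 + a * p z + b * logistic z)).
  + intros z Hz; apply (is_derive_comb3 (fun _ => 0)); [apply @is_derive_const| |apply derive_softplus].
    apply B; lra.
  + intros z Hz; specialize (Hab z Hz); lra.
  + apply vanishes_plus; [apply vanishes_plus|].
    * apply vanishes_0.
    * apply vanishes_scal, B.
    * apply vanishes_scal, vanishes_softplus. }
split.
- assert (H := Hcmp 1 (- INR (S m))); cut (0 <= 0 + 1 * w x + - INR (S m) * ln (1 + exp x)); [lra|].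
  apply H; intros z Hz; generalize (p_bounds z (proj1 (Hlow z Hz)) (proj2 (Hlow z Hz))); lra.
- assert (H := Hcmp (-1) (INR (S m) * (1 + 4 * eps * L))).
  cut (0 <= 0 + -1 * w x + (INR (S m) * (1 + 4 * eps * L)) * ln (1 + exp x)); [lra|].
  apply H; intros z Hz; generalize (p_bounds z (proj1 (Hlow z Hz)) (proj2 (Hlow z Hz))); lra.
Qed.

(** The first factors are the source of the explicit profile. The last exponential compares [h(w)]
    with its value [- n ln (1 + e^x)] on that profile, so it is the only factor still to be
    estimated. *)
Lemma source_eq_profile x : source m h w x =
  INR m * INR (S m) ^ m * (logistic x ^ m * (1 - logistic x)) *
   exp (h (w x) + INR (S m) * ln (1 + exp x)).
Proof.
assert (Hex := exp_pos x).
unfold source; rewrite !exp_plus, !exp_INR_mult, exp_ln by lra.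
replace (1 - logistic x) with (/ (1 + exp x)) by (unfold logistic; field; lra).
unfold logistic, Rdiv; rewrite Rpow_mult_distr, pow_inv; simpl pow.
assert (0 < (1 + exp x) ^ m) by (apply pow_lt; lra).
field; lra.
Qed.

(** Here the condition on [eps L^2] is decisive: a relative error [4 eps L] in [w <= L] is an
    absolute error [4 eps L^2 <= zeta] in the exponent, and [h(w) + w] adds at most [zeta / 4]. *)
Lemma profile_ratio_bounds x : x < X -> w x <= L ->
  1 - zeta <= exp (h (w x) + INR (S m) * ln (1 + exp x)) <= 1 + zeta.
Proof.
intros Hx HwL.
assert (H1 := inner_h x Hx HwL); assert (H2 := w_bounds x Hx HwL).
assert (Hw := bubble_range _ _ _ _ _ _ _ B x Hx).
assert (HeL := inner_epsL).
destruct E as [He Hz HL Hs _].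
assert (Hl := softplus_bounds x).
set (u := INR (S m) * ln (1 + exp x)) in *.
assert (Hu : 0 <= u) by (apply Rmult_le_pos; lra).
assert (Hlow : - zeta <= h (w x) + u).
{ assert (4 * eps * L * u <= 4 * eps * L * L) by (apply Rmult_le_compat_l; [nra|lra]).
  nra. }
assert (Hup : h (w x) + u <= zeta / 4).
{ assert (eps * w x ^ 2 <= eps * L ^ 2); [|lra].
  apply Rmult_le_compat_l; [lra|apply pow_incr; lra]. }
split.
- apply Rle_trans with (1 + (h (w x) + u)); [lra|apply exp_ineq1_le].
- assert (Hi : exp (h (w x) + u) * exp (- (h (w x) + u)) = 1).
  { rewrite <- exp_plus, Rplus_opp_r; apply exp_0. }
  assert (1 + - (h (w x) + u) <= exp (- (h (w x) + u))) by apply exp_ineq1_le.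
  generalize (exp_pos (h (w x) + u)); nra.
Qed.

(** Second pass: the crude bounds are inserted in [Q' = (1 + h') p F]. From above, the slope, [w],
    [p] and the source ratio each contribute [1 + zeta], and [(1 + zeta)^4 <= 1 + 9 zeta] for
    [zeta <= 1 / 2]. From below, [w] and [p] dominate the profile exactly, so only two factors
    [1 - zeta] occur. *)
Lemma defect_profile_bounds x : x < X -> w x <= L ->
  eps * (1 - 2 * zeta) * profile_defect m x <= defect m h w p x
    <= eps * (1 + 9 * zeta) * profile_defect m x.
Proof.
intros Hx HwL.
assert (Hlow : forall z, z <= x -> z < X /\ w z <= L).
{ intros z Hz; split; [lra|]; apply Rle_trans with (2 := HwL).
  now apply bubble_w_increasing. }
set (D z := INR m * INR (S m) ^ S m * INR (S m) * (logistic z ^ S m * (1 - logistic z) * ln (1 + exp z))).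
assert (Hder : forall z, z <= x ->
  0 <= D z /\
  eps * (1 - 2 * zeta) * D z <= (1 + h1 (w z)) * p z * source m h w z <= eps * (1 + 9 * zeta) * D z).
{ intros z Hz; destruct (Hlow z Hz) as [HzX HzL].
  assert (H1 := p_bounds z HzX HzL); assert (H2 := w_bounds z HzX HzL).
  assert (H3 := profile_ratio_bounds z HzX HzL).
  assert (Hw := bubble_range _ _ _ _ _ _ _ B z HzX).
  assert (HeL := inner_epsL).
  destruct E as [He Hzt HL Hs Hsl]; specialize (Hsl (w z) ltac:(lra)).
  assert (Hl := softplus_bounds z); assert (Hlg := logistic_bounds z).
  rewrite source_eq_profile; unfold D.
  set (e := exp (h (w z) + INR (S m) * ln (1 + exp z))) in *.
  set (l := ln (1 + exp z)) in *; set (s := logistic z) in *.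
  assert (Hsm : 0 < s ^ m) by (apply pow_lt; lra).
  assert (HNm : 0 < INR (S m) ^ m) by (apply pow_lt; lra).
  cbn [pow]; set (sm := s ^ m) in *; set (Nm := INR (S m) ^ m) in *.
  set (N := INR (S m)) in *; set (M := INR m) in *.
  set (a := 1 + h1 (w z)) in *.
  assert (HNl : 0 < N * l) by (apply Rmult_lt_0_compat; lra).
  assert (HNs : 0 < N * s) by (apply Rmult_lt_0_compat; lra).
  assert (Ha : eps * (N * l) * (1 - zeta) <= a <= eps * (N * l) * (1 + zeta) ^ 2).
  { split.
    - apply Rle_trans with (2 := proj1 Hsl).
      apply Rmult_le_compat_r; [lra|]; apply Rmult_le_compat_l; lra.
    - apply Rle_trans with (1 := proj2 Hsl).
      replace (eps * (N * l) * (1 + zeta) ^ 2) with (eps * ((N * l) * (1 + zeta)) * (1 + zeta)) by ring.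
      apply Rmult_le_compat_r; [lra|]; apply Rmult_le_compat_l; [lra|].
      apply Rle_trans with (1 := proj2 H2); apply Rmult_le_compat_l; lra. }
  assert (Hp : N * s <= p z <= N * s * (1 + zeta)).
  { split; [easy|]; apply Rle_trans with (1 := proj2 H1); apply Rmult_le_compat_l; lra. }
  set (K := M * Nm * (sm * (1 - s))).
  assert (HK : 0 < K) by (unfold K; repeat apply Rmult_lt_0_compat; lra).
  set (b := eps * (N * l)) in *.
  assert (Hb : 0 < b) by (apply Rmult_lt_0_compat; lra).
  assert (Hap : b * (1 - zeta) * (N * s) <= a * p z <= b * (1 + zeta) ^ 2 * (N * s * (1 + zeta))).
  { assert (0 <= b * (1 - zeta)) by (apply Rmult_le_pos; lra).
    split; apply Rmult_le_compat; lra. }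
  assert (Hz4 : (1 + zeta) ^ 4 <= 1 + 9 * zeta).
  { assert (zeta ^ 2 <= zeta / 2) by nra.
    assert (zeta ^ 3 <= zeta / 4) by nra.
    assert (zeta ^ 4 <= zeta / 8) by nra.
    nra. }
  assert (HbNs : 0 < b * (N * s)) by (apply Rmult_lt_0_compat; lra).
  assert (Hape : b * (N * s) * (1 - 2 * zeta) <= a * p z * e <= b * (N * s) * (1 + 9 * zeta)).
  { split.
    - apply Rle_trans with (b * (1 - zeta) * (N * s) * (1 - zeta)); [nra|].
      apply Rmult_le_compat; try lra.
      apply Rmult_le_pos; [apply Rmult_le_pos|]; lra.
    - apply Rle_trans with (b * (1 + zeta) ^ 2 * (N * s * (1 + zeta)) * (1 + zeta)).
      + apply Rmult_le_compat; try lra.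
        apply Rle_trans with (2 := proj1 Hap); apply Rmult_le_pos; [apply Rmult_le_pos|]; lra.
      + replace (b * (1 + zeta) ^ 2 * (N * s * (1 + zeta)) * (1 + zeta))
          with (b * (N * s) * (1 + zeta) ^ 4) by ring.
        apply Rmult_le_compat_l; lra. }
  replace (M * (N * Nm) * N * (s * sm * (1 - s) * l)) with (K * (N * l) * (N * s)) by (unfold K; ring).
  replace (a * p z * (K * e)) with (K * (a * p z * e)) by ring.
  replace (eps * (1 - 2 * zeta) * (K * (N * l) * (N * s))) with (K * (b * (N * s) * (1 - 2 * zeta)))
    by (unfold b; ring).
  replace (eps * (1 + 9 * zeta) * (K * (N * l) * (N * s))) with (K * (b * (N * s) * (1 + 9 * zeta)))
    by (unfold b; ring).
  split; [apply Rmult_le_pos; [apply Rmult_le_pos|]; lra|].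
  split; apply Rmult_le_compat_l; lra. }
assert (Hcmp : forall c d,
  (forall z, z <= x -> 0 <= c * D z + d * ((1 + h1 (w z)) * p z * source m h w z)) ->
  0 <= 0 + c * profile_defect m x + d * defect m h w p x).
{ intros c d Hcd.
  apply (nonneg_of_derive_minf x
    (fun x => 0 + c * profile_defect m x + d * defect m h w p x)
    (fun z => 0 + c * D z + d * ((1 + h1 (w z)) * p z * source m h w z))).
  - intros z Hz; apply (is_derive_comb3 (fun _ => 0)).
    + apply @is_derive_const.
    + apply derive_profile_defect.
    + apply derive_defect with (1 := B); now apply Hlow.
  - intros z Hz; specialize (Hcd z Hz); lra.
  - apply vanishes_plus; [apply vanishes_plus|].
    + apply vanishes_0.
    + apply vanishes_scal, vanishes_profile_defect.
    + apply vanishes_scal, vanishes_defect. }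
split.
- enough (0 <= 0 + (- (eps * (1 - 2 * zeta))) * profile_defect m x + 1 * defect m h w p x) by lra.
  apply Hcmp; intros z Hz; destruct (Hder z Hz) as [_ [H1 H2]]; lra.
- enough (0 <= 0 + (eps * (1 + 9 * zeta)) * profile_defect m x + (-1) * defect m h w p x) by lra.
  apply Hcmp; intros z Hz; destruct (Hder z Hz) as [_ [H1 H2]]; lra.
Qed.

(** * Position and slope at the matching point [w = L] *)

Lemma bubble_reaches v : 0 < v < W -> exists x, x < X /\ w x = v.
Proof.
intros Hv.
destruct (bubble_w0 _ _ _ _ _ _ _ B v (proj1 Hv)) as [X0 HX0].
destruct (bubble_end _ _ _ _ _ _ _ B (W - v)) as [d [Hd0 Hd]]; [lra|].
set (z2 := X - d / 2).
set (z1 := Rmin z2 X0 - 1).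
assert (Hz12 : z1 < z2) by (unfold z1; generalize (Rmin_l z2 X0); lra).
assert (Hz1 : z1 < X0) by (unfold z1; generalize (Rmin_r z2 X0); lra).
assert (Hz2 : X - d < z2 < X) by (unfold z2; lra).
specialize (HX0 z1 Hz1); apply Rabs_def2 in HX0.
specialize (Hd z2 Hz2).
destruct (IVT_interv (fun x => w x - v) z1 z2) as [z [Hz Hwz]].
- intros a Ha; apply continuity_pt_minus; [|apply continuity_pt_const; now intros ? ?].
  apply derivable_continuous_pt; exists (p a).
  apply is_derive_Reals, B; lra.
- easy.
- lra.
- lra.
- exists z; split; lra.
Qed.

Definition inner_const : R :=
  INR (S m) ^ 2 * (harm (S m) * (9 + 3 * INR (S m) + 6 * 3 ^ m) + INR (S m) + 1) + 8 * INR (S m).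

(** The tail hypothesis makes [1 - logistic x], comparable to [e^(-L / n)], negligible against
    [eps zeta] even after multiplication by [L]. The last conclusion keeps the exponentially small
    deficit of [p] below [n], because the outer region multiplies it by a length of order [W]. *)
Lemma inner_result :
  INR (S m) * zeta <= 1 -> L * exp (- L / INR (S m)) <= eps * zeta ->
  exists x, x < X /\ w x = L /\
    Rabs (p x - (INR (S m) + INR (S m) ^ 2 * harm (S m) * eps)) <= inner_const * (eps * zeta) /\
    0 <= L / INR (S m) - x <= 2 * zeta /\
    INR (S m) * (1 - 2 * exp (- L / INR (S m))) <= p x.
Proof.
intros HNz Htail.
destruct (bubble_reaches L) as [x [Hx HwL]]; [destruct E; lra|].
assert (HwL' : w x <= L) by lra.
exists x; split; [easy|split; [easy|]].
assert (H1 := p_bounds x Hx HwL'); assert (H2 := w_bounds x Hx HwL').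
assert (H3 := defect_profile_bounds x Hx HwL').
assert (H6 := proj1 (defect_bounds x Hx HwL')).
assert (H4 := profile_ratio_bounds x Hx HwL').
assert (H5 := profile_defect_bounds m x).
assert (Hd : defect m h w p x = source m h w x + - INR m * p x ^ m + INR m / INR (S m) * p x ^ S m)
  by reflexivity.
rewrite source_eq_profile in Hd.
assert (Hpx := ppos x Hx).
assert (HeL := inner_epsL).
destruct E as [He Hz HL Hs _].
assert (Hl := softplus_bounds x); assert (Hlg := logistic_bounds x).
assert (HH := harm_pos (S m)).
assert (Hex := exp_pos x).
assert (Hls : logistic x = exp (x - ln (1 + exp x))).
{ unfold Rminus, logistic; rewrite exp_plus, exp_Ropp, exp_ln; [easy|lra]. }
assert (Hs1 : 1 - logistic x = exp (- ln (1 + exp x))).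
{ rewrite exp_Ropp, exp_ln by lra; unfold logistic; field; lra. }
set (l := ln (1 + exp x)) in *.
(* This splitting locates [x]: at [w = L] the softplus [l] is within [zeta] of [L / n], and the
   logarithm lies in [[- zeta / 2, 0]]. *)
assert (Hx_eq : x = l + ln (logistic x)) by (rewrite Hls, ln_exp; ring).
set (e := exp (h (w x) + INR (S m) * l)) in *.
set (s := logistic x) in *; clearbody s e.
set (c := 1 - s) in *.
assert (Hsc : s = 1 - c) by (unfold c; ring).
assert (Hc0 : 0 < c) by (unfold c; lra).
unfold inner_const; set (H := harm (S m)) in *.
assert (HN2 : 2 <= INR (S m)) by lra.
assert (Hpow1 := pow_one_plus_le m zeta Hz).
assert (Hpm1 : INR (S m) ^ m * (1 - INR m * c) <= p x ^ m).
{ apply Rle_trans with ((INR (S m) * s) ^ m); [|apply pow_incr; split; [apply Rmult_le_pos|]; lra].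
  rewrite Rpow_mult_distr; apply Rmult_le_compat_l; [apply pow_le; lra|].
  generalize (one_minus_pow m s ltac:(lra)); fold c; lra. }
assert (Hpm2 : p x ^ m <= INR (S m) ^ m * (1 + 3 ^ m * zeta)).
{ apply Rle_trans with ((INR (S m) * (1 + zeta)) ^ m).
  - apply pow_incr; split; [lra|].
    apply Rle_trans with (1 := proj2 H1).
    assert (0 <= INR (S m) * s <= INR (S m) * 1).
    { split; [apply Rmult_le_pos; lra|apply Rmult_le_compat_l; lra]. }
    apply Rle_trans with (INR (S m) * s * (1 + zeta)); [apply Rmult_le_compat_l; lra|].
    apply Rmult_le_compat_r; lra.
  - rewrite Rpow_mult_distr; apply Rmult_le_compat_l; [apply pow_le; lra|easy]. }
assert (HNm : 0 < INR (S m) ^ m) by (apply pow_lt; lra).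
assert (Hsm : 0 <= s ^ m <= 1).
{ split; [apply pow_le; lra|rewrite <- (pow1 m); apply pow_incr; lra]. }
cbn [pow] in H5, Hd.
set (T := exp (- L / INR (S m))) in *.
(* [c = e^(-l)] with [l >= L / n - 1 / 2], and the factor [2] bounds [e^(1/2)], because
   [e^(-1/2) >= 1 / 2]. *)
assert (HcT : c <= 2 * T).
{ rewrite Hs1.
  assert (Hll : L / INR (S m) - 1 / 2 <= l).
  { apply Rle_minus_l, Rle_div_l; [lra|].
    assert (4 * eps * L * (INR (S m) * l) <= 4 * eps * L * L)
      by (apply Rmult_le_compat_l; [repeat apply Rmult_le_pos|]; lra).
    lra. }
  apply Rle_trans with (exp (1 / 2 + - L / INR (S m))).
  - assert (Hle : - l <= 1 / 2 + - L / INR (S m)) by (unfold Rdiv in *; lra).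
    destruct Hle as [Hlt|Heq]; [left; now apply exp_increasing|rewrite Heq; lra].
  - rewrite exp_plus; apply Rmult_le_compat_r; [left; apply exp_pos|].
    assert (exp (1 / 2) * exp (- (1 / 2)) = 1) by (rewrite <- exp_plus, Rplus_opp_r; apply exp_0).
    assert (1 + - (1 / 2) <= exp (- (1 / 2))) by apply exp_ineq1_le.
    assert (exp (1 / 2) * (1 / 2) <= exp (1 / 2) * exp (- (1 / 2)))
      by (apply Rmult_le_compat_l; [left; apply exp_pos|lra]).
    lra. }
assert (HT0 : 0 < T) by apply exp_pos.
assert (HcL : c * L <= 2 * (eps * zeta)).
{ assert (c * L <= 2 * T * L) by (apply Rmult_le_compat_r; lra); lra. }
assert (Hce : c <= 2 * (eps * zeta)).
{ assert (c * 1 <= c * L) by (apply Rmult_le_compat_l; lra); lra. }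
assert (Heps : eps <= 1 / 8).
{ assert (eps * 1 <= eps * L) by (apply Rmult_le_compat_l; lra); lra. }
assert (Hcz : c <= zeta / 4).
{ assert (eps * zeta <= 1 / 8 * zeta) by (apply Rmult_le_compat_r; lra); lra. }
split; [|split].
- set (N := INR (S m)) in *; set (M := INR m) in *; set (P := p x ^ m) in *.
  set (Q := defect m h w p x) in *.
  set (Nm := N ^ m) in *; set (k3 := 3 ^ m) in *.
  assert (Hk3 : 1 <= k3) by (apply pow_R1_Rle; lra).
  clearbody Q P Nm k3 T H.
  assert (HMc : M * c <= 1 / 4).
  { assert (M * c <= M * (zeta / 4)) by (apply Rmult_le_compat_l; lra).
    assert (M * zeta <= N * zeta) by (apply Rmult_le_compat_r; lra).
    lra. }
  assert (HP : 0 < P).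
  { apply Rlt_le_trans with (2 := Hpm1); apply Rmult_lt_0_compat; lra. }
  set (F := M * Nm * (s ^ m * c) * e) in *.
  assert (HF : 0 <= F <= 2 * (M * Nm * c)).
  { unfold F; rewrite !Rmult_assoc.
    assert (0 <= s ^ m * (c * e) <= 2 * c).
    { assert (Hce2 : 0 <= c * e) by (apply Rmult_le_pos; lra).
      assert (c * e <= c * 2) by (apply Rmult_le_compat_l; lra).
      split; [apply Rmult_le_pos; lra|].
      apply Rle_trans with (1 * (c * e)); [apply Rmult_le_compat_r; lra|lra]. }
    split; [repeat apply Rmult_le_pos; lra|].
    replace (2 * (M * (Nm * c))) with (M * (Nm * (2 * c))) by ring.
    repeat apply Rmult_le_compat_l; lra. }
  clearbody F.
  set (r := Q / (eps * (M * (N * Nm)))).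
  set (a := P / Nm).
  assert (HMN : 0 < M * (N * Nm)) by (repeat apply Rmult_lt_0_compat; lra).
  assert (HeMN : 0 < eps * (M * (N * Nm))) by (apply Rmult_lt_0_compat; lra).
  assert (HQ : Q = r * (eps * (M * (N * Nm)))) by (unfold r; field; repeat split; lra).
  assert (HPa : P = a * Nm) by (unfold a; field; lra).
  assert (Ha1 : 1 - M * c <= a) by (unfold a; apply Rle_div_r; lra).
  assert (Ha2 : a <= 1 + k3 * zeta) by (unfold a; apply Rle_div_l; lra).
  assert (Ha0 : 3 / 4 <= a) by lra.
  assert (Hr2 : 0 <= r <= (1 + 9 * zeta) * H).
  { unfold r; split; [apply le_div; lra|].
    apply Rle_div_l; [lra|]; apply Rle_trans with (1 := proj2 H3).
    replace ((1 + 9 * zeta) * H * (eps * (M * (N * Nm)))) with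
      (eps * (1 + 9 * zeta) * (M * (N * Nm) * H)) by ring.
    apply Rmult_le_compat_l; [apply Rmult_le_pos|]; lra. }
  assert (HNlL : N * l <= L) by lra.
  assert (Hr1 : (1 - 2 * zeta) * (H - c * (N + L)) <= r).
  { unfold r; apply le_div; [lra|]; apply Rle_trans with (2 := proj1 H3).
    replace ((1 - 2 * zeta) * (H - c * (N + L)) * (eps * (M * (N * Nm)))) with
      (eps * (1 - 2 * zeta) * (M * (N * Nm) * (H - c * (N + L)))) by ring.
    apply Rmult_le_compat_l; [apply Rmult_le_pos; lra|].
    apply Rle_trans with (2 := proj1 H5); apply Rmult_le_compat_l; [lra|].
    assert (c * (N + N * l) <= c * (N + L)) by (apply Rmult_le_compat_l; lra); lra. }
  assert (Heq : (p x - N) * a = N ^ 2 * eps * r - N * (F / (M * Nm))).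
  { apply (Rmult_eq_reg_l (M / N * Nm)); [|apply Rgt_not_eq; unfold Rdiv;
      repeat apply Rmult_lt_0_compat; try lra; apply Rinv_0_lt_compat; lra].
    replace (M / N * Nm * ((p x - N) * a)) with (M / N * (p x * (a * Nm)) - M * (a * Nm))
      by (field; lra).
    rewrite <- HPa.
    replace (M / N * (p x * P) - M * P) with (Q - F) by lra.
    rewrite HQ; field; lra. }
  set (phi := F / (M * Nm)) in *.
  assert (Hphi : 0 <= phi <= 2 * c).
  { assert (HMNm : 0 < M * Nm) by (apply Rmult_lt_0_compat; lra).
    unfold phi; split; [apply le_div; lra|apply Rle_div_l; lra]. }
  clearbody phi a r.
  apply (perturbation_arith N M k3 H eps zeta c L a r phi (p x)); lra.
- assert (Hlns : - (zeta / 2) <= ln s <= 0).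
  { split.
    - assert (Hi : s * exp (- ln s) = 1).
      { rewrite exp_Ropp, exp_ln by lra; field; lra. }
      assert (1 + - ln s <= exp (- ln s)) by apply exp_ineq1_le.
      assert (exp (- ln s) <= 1 + zeta / 2); [|lra].
      apply Rmult_le_reg_r with s; [lra|].
      assert ((1 + zeta / 2) * (1 - zeta / 4) <= (1 + zeta / 2) * s) by (apply Rmult_le_compat_l; lra).
      assert (zeta * zeta <= 1 / 2 * zeta) by (apply Rmult_le_compat_r; lra).
      lra.
    - rewrite <- ln_1; apply ln_le; lra. }
  assert (HlL : 0 <= L / INR (S m) - l <= zeta).
  { split.
    - assert (l <= L / INR (S m)) by (apply le_div; lra); lra.
    - apply Rle_minus_l, Rle_div_l; [lra|].
      assert (4 * eps * L * (INR (S m) * l) <= 4 * eps * L * L)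
        by (apply Rmult_le_compat_l; [repeat apply Rmult_le_pos|]; lra).
      assert (zeta * 1 <= zeta * INR (S m)) by (apply Rmult_le_compat_l; lra).
      lra. }
  lra.
- apply Rle_trans with (2 := proj1 H1); apply Rmult_le_compat_l; lra.
Qed.

End Inner.

(** * The outer region *)

(** Transfers an upper bound on the growth of [p ^ m] to [p] without taking roots; in the outer
    region [p >= 1]. *)
Lemma sub_le_pow_sub (k : nat) a b : (1 <= k)%nat -> 1 <= a <= b -> b - a <= b ^ k - a ^ k.
Proof.
intros Hk Hab; destruct k as [|k]; [lia|clear Hk].
induction k as [|k IH]; [simpl; lra|].
assert (H1 : 1 <= a ^ S k) by (apply pow_R1_Rle; lra).
cbn [pow] in *.
assert (1 * (b * b ^ k - a * a ^ k) <= b * (b * b ^ k - a * a ^ k)) by (apply Rmult_le_compat_r; lra).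
assert ((b - a) * 1 <= (b - a) * (a * a ^ k)) by (apply Rmult_le_compat_l; lra).
lra.
Qed.

Lemma le_of_le_left (a b c q X : R) : a < X -> 0 <= q ->
  (forall x, a < x < X -> b + q * x <= c) -> b + q * X <= c.
Proof.
intros HaX Hq H; apply le_epsilon; intros e He.
set (d := Rmin ((X - a) / 2) (e / (q + 1))).
assert (Hd0 : 0 < d) by (apply Rmin_glb_lt; apply Rdiv_lt_0_compat; lra).
assert (Hd1 : d <= (X - a) / 2) by apply Rmin_l.
assert (Hd2 : d <= e / (q + 1)) by apply Rmin_r.
apply Rle_div_r in Hd2; [|lra].
specialize (H (X - d) ltac:(lra)); nra.
Qed.

Lemma increment_ge_of_derive (a b q : R) (f f' : R -> R) :
  (forall x, a <= x <= b -> is_derive f x (f' x)) ->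
  (forall x, a <= x <= b -> q <= f' x) -> a <= b -> f a + q * (b - a) <= f b.
Proof.
intros Hd Hq Hab.
enough (0 + 1 * f a + (- q) * a <= 0 + 1 * f b + (- q) * b) by lra.
apply (increasing_of_derive a b (fun x => 0 + 1 * f x + (- q) * x) (fun x => 0 + 1 * f' x + (- q) * 1));
  [| |easy]; intros x Hx.
- apply (is_derive_comb3 (fun _ => 0) f (fun x => x));
    [apply @is_derive_const|now apply Hd|apply @is_derive_id].
- specialize (Hq x Hx); lra.
Qed.

Section Outer.
Context (m : nat) (h h1 : R -> R) (W X : R) (w p : R -> R)
  (B : bubble m h h1 W X w p) (x1 L t A b : R).

Let HM : 1 <= INR m.
Proof. apply (le_INR 1), B. Qed.

Let HN : INR (S m) = INR m + 1.
Proof. apply S_INR. Qed.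

Lemma bubble_p_increasing x z : x <= z -> z < X -> p x <= p z.
Proof.
intros Hxz Hz; apply pow_le_inv with m; [apply B|left; apply B; lra|].
apply (increasing_of_derive x z (fun x => p x ^ m) (source m h w)); [| |easy]; intros u Hu.
- apply B; lra.
- left; apply source_pos, B.
Qed.

(** Since [p] increases, [W - w >= p1 (X - x) >= (n / 2) (X - x)], which converts decay in [W - w]
    into the factor [e^(-(X - x) / 4)]. Integrating that factor once gives [4 A], twice [16 A],
    while the constant [b] acts over a length at most [W]. The last quantity bounded is what the
    growth of [p] beyond [x1] adds to [w]. *)
Lemma outer_result :
  x1 < X -> w x1 = L -> 0 < L -> 1 <= W -> 0 < t -> 4 * t * W <= 1 ->
  INR (S m) * (1 - 2 * t) <= p x1 -> x1 <= L / INR (S m) -> 0 <= A -> 0 <= b ->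
  (forall v, L <= v < W ->
     exp (h v + INR m / INR (S m) * v) <= A * exp (- (INR m / (2 * INR (S m))) * (W - v)) + b) ->
  let K := 3 * (INR m * INR (S m) ^ m) in
  (forall x, x1 <= x < X -> p x1 <= p x <= p x1 + K * (4 * A + b * W)) /\
  0 <= W - L - p x1 * (X - x1) <= K * (16 * A + b * W ^ 2).
Proof.
intros Hx1 HwL HL HW Ht HtW Hp1 HxL HA Hb Hbound K.
set (N := INR (S m)) in *; set (M := INR m) in *.
assert (Ht4 : t <= 1 / 4).
{ assert (t * 1 <= t * W) by (apply Rmult_le_compat_l; lra); lra. }
assert (HNt : N * (1 / 2) <= N * (1 - 2 * t)) by (apply Rmult_le_compat_l; lra).
assert (HLW : L < W) by (rewrite <- HwL; now apply B).
assert (HK : 0 < K).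
{ unfold K; repeat apply Rmult_lt_0_compat; try lra; apply pow_lt; lra. }
set (p1 := p x1) in *.
assert (Hpge : forall x, x1 <= x < X -> p1 <= p x).
{ intros x Hx; apply bubble_p_increasing; lra. }
assert (Hinc : forall x z, x1 <= x -> x <= z -> z < X -> w x + p1 * (z - x) <= w z).
{ intros x z Hx Hxz Hz; apply increment_ge_of_derive with p; [| |easy]; intros u Hu.
  - apply B; lra.
  - apply Hpge; lra. }
assert (Hremain : forall x, x1 <= x < X -> w x + p1 * (X - x) <= W).
{ intros x Hx.
  assert (w x - p1 * x + p1 * X <= W); [|lra].
  apply le_of_le_left with x; [lra|lra|]; intros z Hz.
  assert (w z < W) by (apply B; lra).
  specialize (Hinc x z ltac:(lra) ltac:(lra) ltac:(lra)); lra. }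
assert (Hlen : X - x1 <= W).
{ specialize (Hremain x1 ltac:(lra)).
  assert (1 * (X - x1) <= p1 * (X - x1)) by (apply Rmult_le_compat_r; lra).
  lra. }
set (g x := exp ((x - X) / 4)).
assert (Hg1 : forall x, x < X -> 0 <= g x <= 1).
{ intros x Hx; unfold g; split; [left; apply exp_pos|].
  rewrite <- exp_0; apply exp_le; lra. }
assert (Dg : forall x, is_derive (fun x => g x) x (g x / 4)).
{ intros x; unfold g; auto_derive; [easy|]; unfold Rdiv, Rminus; field. }
assert (HF : forall x, x1 <= x < X -> source m h w x <= K * (A * g x + b)).
{ intros x Hx.
  assert (Hwx : L <= w x < W).
  { split; [|apply B; lra].
    specialize (Hinc x1 x ltac:(lra) ltac:(lra) ltac:(lra)).
    assert (0 <= p1 * (x - x1)) by (apply Rmult_le_pos; lra); lra. }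
  (* The slope may fall short of [n] by [2 t n], over a length at most [2 W / n]; the total loss is
     [4 t W <= 1]. It costs a factor [e <= 3] in the source, the [3] in [K]. *)
  assert (Hxw : N * x <= w x + 4 * t * W).
  { assert (HNL : N * x1 <= L).
    { apply (Rmult_le_compat_l N) in HxL; [|lra].
      replace (N * (L / N)) with L in HxL by (field; lra); lra. }
    specialize (Hinc x1 x ltac:(lra) ltac:(lra) ltac:(lra)).
    assert (N * (1 - 2 * t) * (x - x1) <= p1 * (x - x1)) by (apply Rmult_le_compat_r; lra).
    assert (HNx : N * (1 / 2) * (x - x1) <= W).
    { apply Rle_trans with (p1 * (x - x1)); [apply Rmult_le_compat_r; lra|lra]. }
    assert (t * (N * (x - x1)) <= t * (2 * W)) by (apply Rmult_le_compat_l; lra).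
    lra. }
  assert (HMx : M * x <= M / N * w x + 1).
  { assert (HMN : 0 <= M / N <= 1).
    { split; [apply Rmult_le_pos; [lra|left; apply Rinv_0_lt_compat; lra]|apply Rle_div_l; lra]. }
    replace (M * x) with (M / N * (N * x)) by (field; lra).
    apply Rle_trans with (M / N * (w x + 1)); [apply Rmult_le_compat_l; lra|lra]. }
  unfold source; fold N M; unfold K.
  replace (3 * (M * N ^ m) * (A * g x + b)) with (M * N ^ m * (3 * (A * g x + b))) by ring.
  apply Rmult_le_compat_l; [unfold K in HK; lra|].
  apply Rle_trans with (exp (1 + (h (w x) + M / N * w x))); [apply exp_le; lra|].
  rewrite exp_plus.
  apply Rmult_le_compat; [left; apply exp_pos|left; apply exp_pos|apply exp_le_3|].
  apply Rle_trans with (1 := Hbound (w x) Hwx).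
  apply Rplus_le_compat_r, Rmult_le_compat_l; [easy|].
  unfold g; apply exp_le.
  specialize (Hremain x Hx).
  assert (HMN : 0 < M / (2 * N)) by (apply Rdiv_lt_0_compat; lra).
  assert (M / (2 * N) * (N * (1 / 2) * (X - x)) <= M / (2 * N) * (W - w x)).
  { apply Rmult_le_compat_l; [lra|].
    apply Rle_trans with (p1 * (X - x)); [apply Rmult_le_compat_r; lra|lra]. }
  replace (M / (2 * N) * (N * (1 / 2) * (X - x))) with (M * (X - x) / 4) in H by (field; lra).
  assert (1 * (X - x) <= M * (X - x)) by (apply Rmult_le_compat_r; lra).
  lra. }
assert (Hpup : forall x, x1 <= x < X -> p x <= p1 + K * (4 * A * g x + b * (x - x1))).
{ intros x Hx.
  (* The comparison is made on [p ^ m], whose derivative is the source; [4 A g + b x] is a primitive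
     of [A g + b], because [g' = g / 4]. *)
  assert (Hpow : p x ^ m - p1 ^ m <= K * (4 * A * g x + b * (x - x1))).
  { assert (Hmono : 0 + K * (4 * A * g x1 + b * x1) + (-1) * p1 ^ m
       <= 0 + K * (4 * A * g x + b * x) + (-1) * p x ^ m).
    { apply (increasing_of_derive x1 x (fun x => 0 + K * (4 * A * g x + b * x) + (-1) * p x ^ m)
        (fun x => 0 + K * (A * g x + b) + (-1) * source m h w x)); [| |lra]; intros u Hu.
      - apply (is_derive_comb3 (fun _ => 0) (fun x => 4 * A * g x + b * x) (fun x => p x ^ m)).
        + apply @is_derive_const.
        + apply is_derive_eq with (0 + 4 * A * (g u / 4) + b * 1); [|field].
          apply (is_derive_ext (fun x => 0 + 4 * A * g x + b * x)); [intros; cbv beta; lra|].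
          apply (is_derive_comb3 (fun _ => 0) g (fun x => x));
            [apply @is_derive_const|apply Dg|apply @is_derive_id].
        + apply B; lra.
      - specialize (HF u ltac:(lra)); lra. }
    assert (0 <= K * (4 * A * g x1)).
    { apply Rmult_le_pos; [lra|]; apply Rmult_le_pos; [lra|]; apply Hg1; lra. }
    lra. }
  generalize (sub_le_pow_sub m p1 (p x) (bubble_m _ _ _ _ _ _ _ B) ltac:(split; [lra|now apply Hpge])).
  lra. }
assert (HbW : forall x, x1 <= x < X -> b * (x - x1) <= b * W).
{ intros x Hx; apply Rmult_le_compat_l; lra. }
split.
- intros x Hx; split; [now apply Hpge|].
  apply Rle_trans with (1 := Hpup x Hx), Rplus_le_compat_l, Rmult_le_compat_l; [lra|].
  specialize (HbW x Hx); specialize (Hg1 x ltac:(lra)).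
  assert (A * g x <= A * 1) by (apply Rmult_le_compat_l; lra); lra.
- split; [specialize (Hremain x1 ltac:(lra)); lra|].
  assert (Hw : forall x, x1 <= x < X -> w x <= L + p1 * (x - x1) + K * (16 * A * g x + b * W * (x - x1))).
  { intros x Hx.
    assert (Hmono : 0 + 1 * (K * (16 * A * g x1 + b * W * x1) + p1 * x1) + (-1) * w x1
       <= 0 + 1 * (K * (16 * A * g x + b * W * x) + p1 * x) + (-1) * w x).
    { apply (increasing_of_derive x1 x
        (fun x => 0 + 1 * (K * (16 * A * g x + b * W * x) + p1 * x) + (-1) * w x)
        (fun x => 0 + 1 * (K * (4 * A * g x + b * W) + p1) + (-1) * p x)); [| |lra]; intros u Hu.
      - apply (is_derive_comb3 (fun _ => 0) (fun x => K * (16 * A * g x + b * W * x) + p1 * x) w).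
        + apply @is_derive_const.
        + apply is_derive_eq with (0 + K * 16 * A * (g u / 4) + (K * b * W + p1) * 1); [|field].
          apply (is_derive_ext (fun x => 0 + K * 16 * A * g x + (K * b * W + p1) * x));
            [intros; cbv beta; lra|].
          apply (is_derive_comb3 (fun _ => 0) g (fun x => x));
            [apply @is_derive_const|apply Dg|apply @is_derive_id].
        + apply B; lra.
      - specialize (Hpup u ltac:(lra)); specialize (HbW u ltac:(lra)).
        assert (K * (b * (u - x1)) <= K * (b * W)) by (apply Rmult_le_compat_l; lra).
        lra. }
    assert (0 <= K * (16 * A * g x1)).
    { apply Rmult_le_pos; [lra|]; apply Rmult_le_pos; [lra|]; apply Hg1; lra. }
    lra. }
  apply le_epsilon; intros e He.
  destruct (bubble_end _ _ _ _ _ _ _ B e He) as [d [Hd0 Hd]].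
  set (z := Rmax x1 (X - d / 2)).
  assert (Hz1 : x1 <= z) by apply Rmax_l.
  assert (Hz2 : X - d / 2 <= z) by apply Rmax_r.
  assert (Hz3 : z < X) by (apply Rmax_lub_lt; lra).
  specialize (Hd z ltac:(lra)); specialize (Hw z ltac:(lra)).
  specialize (Hg1 z Hz3).
  assert (p1 * (z - x1) <= p1 * (X - x1)) by (apply Rmult_le_compat_l; lra).
  assert (K * (16 * A * g z + b * W * (z - x1)) <= K * (16 * A + b * W ^ 2)).
  { apply Rmult_le_compat_l; [lra|].
    assert (A * g z <= A * 1) by (apply Rmult_le_compat_l; lra).
    assert (b * W * (z - x1) <= b * W * W).
    { apply Rmult_le_compat_l; [apply Rmult_le_pos|]; lra. }
    lra. }
  lra.
Qed.

End Outer.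

Lemma inner_const_pos m : 0 <= inner_const m.
Proof.
unfold inner_const.
assert (HN := pos_INR (S m)); assert (HH := harm_pos (S m)).
assert (0 <= 3 ^ m) by (apply pow_le; lra).
assert (0 <= INR (S m) ^ 2) by apply pow2_ge_0.
apply Rplus_le_le_0_compat; [|lra].
repeat first [apply Rplus_le_le_0_compat | apply Rmult_le_pos]; lra.
Qed.

(* With [y = X - x1], [u = N H eps + v] and [rho] the gap of [outer_result], the relation
   [N (1 + u) y = W - L - rho] gives
   [X - W / N + H eps W = (x1 - L / N) + H eps (L + N u y + rho) - v y - rho / N]. *)
Lemma bubble_asymptotics (m : nat) (A D : R) : 0 <= A -> 0 <= D ->
  exists C, 0 <= C /\ forall h h1 W X w p eps zeta L E,
  bubble m h h1 W X w p -> near_exponential h1 eps zeta L -> L < W ->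
  INR (S m) * zeta <= 1 ->
  (1 + W) ^ 2 * exp (- L / (2 * INR (S m))) <= eps * zeta ->
  0 <= E -> W * eps <= D ->
  (forall v, L <= v < W ->
     exp (h v + INR m / INR (S m) * v) <=
     A * E * exp (- (INR m / (2 * INR (S m))) * (W - v)) + exp (- L / (2 * INR (S m)))) ->
  (exists x1, x1 < X /\ forall x, x1 <= x < X ->
    Rabs (p x - (INR (S m) + INR (S m) ^ 2 * harm (S m) * eps)) <= C * (eps * zeta + E)) /\
  Rabs (X - W / INR (S m) + harm (S m) * eps * W) <= C * (zeta + E).
Proof.
intros HA HD.
set (K := 3 * (INR m * INR (S m) ^ m)).
set (C1 := inner_const m); set (H := harm (S m)); set (N := INR (S m)).
assert (HN : 1 <= N) by (apply (le_INR 1); lia).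
assert (HK : 0 <= K).
{ unfold K; apply Rmult_le_pos; [lra|apply Rmult_le_pos; [apply pos_INR|apply pow_le, pos_INR]]. }
assert (HC1 : 0 <= C1) by apply inner_const_pos.
assert (HH : 0 < H) by apply harm_pos.
set (R0 := K * (16 * A + 1)).
assert (HR0 : 0 <= R0) by (apply Rmult_le_pos; lra).
set (U := N * H + C1).
assert (HU : 0 <= U) by (unfold U; apply Rplus_le_le_0_compat; [apply Rmult_le_pos|]; lra).
assert (HHN : 0 <= H * N) by (apply Rmult_le_pos; lra).
assert (HHNUD : 0 <= H * N * (U * D)) by (apply Rmult_le_pos; [|apply Rmult_le_pos]; lra).
assert (HHR0 : 0 <= H * R0) by (apply Rmult_le_pos; lra).
assert (HC1D : 0 <= C1 * D) by (apply Rmult_le_pos; lra).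
exists (C1 + R0 + (2 + H + H * N * (U * D) + H * R0 + C1 * D)); split; [lra|].
intros h h1 W X w p eps zeta L E B Ne HLW HNz Htail HE HWe Hout.
assert (He := ne_eps _ _ _ _ Ne); assert (Hz := ne_zeta _ _ _ _ Ne).
assert (HL := ne_L _ _ _ _ Ne); assert (Hs := ne_small _ _ _ _ Ne).
set (kap := exp (- L / (2 * N))) in *.
assert (Hkap : 0 < kap) by apply exp_pos.
assert (HkW : kap * W <= eps * zeta /\ kap * W ^ 2 <= eps * zeta).
{ assert (kap * W <= kap * (1 + W) ^ 2) by (apply Rmult_le_compat_l; nra).
  assert (kap * W ^ 2 <= kap * (1 + W) ^ 2) by (apply Rmult_le_compat_l; nra).
  lra. }
assert (HeL : eps * L <= eps * L ^ 2) by (apply Rmult_le_compat_l; nra).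
assert (HeL1 : eps * 1 <= eps * L) by (apply Rmult_le_compat_l; lra).
assert (Heps : eps <= zeta / 4) by lra.
assert (Hez : 0 <= eps * zeta <= 1 / 16).
{ split; [apply Rmult_le_pos; lra|].
  assert (eps * zeta <= 1 / 8 * zeta) by (apply Rmult_le_compat_r; lra); lra. }
assert (Hexp : exp (- L / N) <= kap).
{ apply exp_le.
  assert (L / (2 * N) <= L / N); [|unfold Rdiv in *; lra].
  apply Rmult_le_compat_l; [lra|]; apply Rinv_le_contravar; lra. }
destruct (inner_result m h h1 W X w p B eps zeta L Ne HLW HNz) as [x1 [Hx1 [HwL [Hp [Hx Hplow]]]]].
{ fold N; apply Rle_trans with (L * kap); [apply Rmult_le_compat_l; lra|].
  apply Rle_trans with (kap * W); [|apply HkW].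
  rewrite Rmult_comm; apply Rmult_le_compat_l; lra. }
fold N H C1 in Hp, Hx, Hplow.
(* [kap] serves twice: as the slope deficit, since [e^(-L / n) <= kap], and as the additive part of
   the source bound. *)
destruct (outer_result m h h1 W X w p B x1 L kap (A * E) kap) as [Ho1 Ho2]; try lra.
- fold N; apply Rle_trans with (2 := Hplow), Rmult_le_compat_l; lra.
- fold N; lra.
- apply Rmult_le_pos; lra.
- exact Hout.
- fold K N in Ho1, Ho2.
  assert (HAE : 0 <= A * E) by (apply Rmult_le_pos; lra).
  split.
  + exists x1; split; [easy|]; intros x Hx'; specialize (Ho1 x Hx').
    assert (Hgap : K * (4 * (A * E) + kap * W) <= R0 * (eps * zeta + E)).
    { unfold R0; rewrite Rmult_assoc; apply Rmult_le_compat_l; [easy|].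
      assert (0 <= A * (eps * zeta)) by (apply Rmult_le_pos; lra).
      lra. }
    assert (0 <= (2 + H + H * N * (U * D) + H * R0 + C1 * D) * (eps * zeta + E))
      by (apply Rmult_le_pos; lra).
    assert (0 <= C1 * E) by (apply Rmult_le_pos; lra).
    apply Rabs_le_between in Hp.
    apply Rabs_le; lra.
  + set (rho := W - L - p x1 * (X - x1)) in *.
    assert (Hrho : 0 <= rho <= R0 * (zeta + E)).
    { split; [lra|]; apply Rle_trans with (1 := proj2 Ho2).
      unfold R0; rewrite Rmult_assoc; apply Rmult_le_compat_l; [easy|].
      assert (0 <= A * zeta) by (apply Rmult_le_pos; lra).
      assert (eps * zeta <= 1 * zeta) by (apply Rmult_le_compat_r; lra).
      lra. }
    set (y := X - x1) in *.
    set (v := (p x1 - (N + N ^ 2 * H * eps)) / N).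
    assert (Hv : Rabs v <= C1 * (eps * zeta)).
    { unfold v, Rdiv; rewrite Rabs_mult, (Rabs_pos_eq (/ N)) by (left; apply Rinv_0_lt_compat; lra).
      assert (0 < / N <= 1).
      { split; [apply Rinv_0_lt_compat; lra|rewrite <- Rinv_1; apply Rinv_le_contravar; lra]. }
      apply Rle_trans with (C1 * (eps * zeta) * 1); [|lra].
      apply Rmult_le_compat; [apply Rabs_pos|lra|exact Hp|lra]. }
    assert (Hpv : p x1 = N * (1 + (N * H * eps + v))) by (unfold v; field; lra).
    assert (Hp1 : 1 / 2 * N <= p x1).
    { apply Rle_trans with (2 := Hplow).
      assert (exp (- L / N) * 1 <= kap * W).
      { apply Rmult_le_compat; try lra; left; apply exp_pos. }
      assert (N * (1 / 2) <= N * (1 - 2 * exp (- L / N))) by (apply Rmult_le_compat_l; lra).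
      lra. }
    assert (HN2 : 2 <= N).
    { apply (le_INR 2); generalize (bubble_m _ _ _ _ _ _ _ B); lia. }
    assert (Hy : 0 <= y <= W).
    { split; [unfold y; lra|].
      assert (1 * y <= p x1 * y) by (apply Rmult_le_compat_r; unfold y; lra).
      unfold rho in Hrho; lra. }
    set (u := N * H * eps + v) in *.
    assert (Hu : Rabs u <= U * eps).
    { unfold u; apply Rle_trans with (1 := Rabs_triang _ _).
      rewrite Rabs_pos_eq by (apply Rmult_le_pos; [apply Rmult_le_pos|]; lra).
      unfold U; assert (C1 * (eps * zeta) <= C1 * eps) by (apply Rmult_le_compat_l; [lra|];
        rewrite <- (Rmult_1_r eps) at 2; apply Rmult_le_compat_l; lra).
      lra. }
    assert (Hid : X - W / N + H * eps * W =
      (x1 - L / N) + H * eps * L + H * eps * rho + H * N * eps * (u * y) - v * y - rho / N).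
    { assert (HW : W = N * (1 + u) * y + L + rho) by (unfold rho; rewrite Hpv; ring).
      rewrite HW; replace X with (x1 + y) by (unfold y; ring).
      unfold u; field; lra. }
    rewrite Hid.
    assert (HeW : eps * y <= D).
    { apply Rle_trans with (eps * W); [apply Rmult_le_compat_l; lra|lra]. }
    assert (Huy : Rabs (u * y) <= U * D).
    { rewrite Rabs_mult, (Rabs_pos_eq y) by lra.
      apply Rle_trans with (U * eps * y); [apply Rmult_le_compat_r; lra|].
      rewrite Rmult_assoc; apply Rmult_le_compat_l; lra. }
    assert (Hvy : Rabs (v * y) <= C1 * D * zeta).
    { rewrite Rabs_mult, (Rabs_pos_eq y) by lra.
      apply Rle_trans with (C1 * (eps * zeta) * y); [apply Rmult_le_compat_r; lra|].
      replace (C1 * (eps * zeta) * y) with (C1 * zeta * (eps * y)) by ring.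
      replace (C1 * D * zeta) with (C1 * zeta * D) by ring.
      apply Rmult_le_compat_l; [apply Rmult_le_pos|]; lra. }
    apply Rabs_le_between in Huy; apply Rabs_le_between in Hvy.
    assert (Hr : 0 <= rho / N <= rho).
    { split; [apply le_div; lra|apply Rle_div_l; [lra|]].
      assert (rho * 1 <= rho * N) by (apply Rmult_le_compat_l; lra); lra. }
    assert (H * (eps * L) <= H * zeta) by (apply Rmult_le_compat_l; lra).
    assert (0 <= H * (eps * L)) by (apply Rmult_le_pos; [|apply Rmult_le_pos]; lra).
    assert (0 <= H * eps * rho <= H * R0 * (zeta + E)).
    { split; [apply Rmult_le_pos; [apply Rmult_le_pos|]; lra|].
      rewrite Rmult_assoc, (Rmult_assoc H R0); apply Rmult_le_compat_l; [lra|].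
      assert (eps * rho <= 1 * rho) by (apply Rmult_le_compat_r; lra); lra. }
    assert (HHNe : 0 <= H * N * eps <= H * N * zeta).
    { split; [apply Rmult_le_pos; lra|apply Rmult_le_compat_l; lra]. }
    assert (Hcross : Rabs (H * N * eps * (u * y)) <= H * N * (U * D) * zeta).
    { rewrite Rabs_mult, (Rabs_pos_eq (H * N * eps)) by lra.
      apply Rle_trans with (H * N * zeta * (U * D)); [|lra].
      apply Rmult_le_compat; [lra|apply Rabs_pos|lra|apply Rabs_le; lra]. }
    apply Rabs_le_between in Hcross.
    assert (0 <= C1 * (zeta + E)) by (apply Rmult_le_pos; lra).
    assert (0 <= (2 + H + H * N * (U * D) + C1 * D) * E) by (apply Rmult_le_pos; lra).
    apply Rabs_le; lra.
Qed.

(** * Rescaling the shooting problem *)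

Lemma lt_lim_of_increasing (y : R -> R) (l T t : R) :
  (forall s u, T <= s -> s < u -> y s < y u) -> lim_infty y l -> T < t -> y t < l.
Proof.
intros Hinc Hlim Ht.
apply Rlt_le_trans with (y (t + 1)); [apply Hinc; lra|].
apply le_epsilon; intros e He; destruct (Hlim e He) as [M HM].
set (s := Rmax (M + 1) (t + 2)).
assert (M + 1 <= s) by apply Rmax_l; assert (t + 2 <= s) by apply Rmax_r.
specialize (HM s ltac:(lra)); apply Rabs_def2 in HM.
specialize (Hinc (t + 1) s ltac:(lra) ltac:(lra)); lra.
Qed.

Lemma derive_nonneg_of_increasing (y : R -> R) (T t l : R) :
  (forall s u, T <= s -> s < u -> y s < y u) -> T < t -> derivable_pt_lim y t l -> 0 <= l.
Proof.
intros Hinc Ht Hd; destruct (Rle_lt_dec 0 l) as [Hl|Hl]; [easy|exfalso].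
destruct (Hd (- l) ltac:(lra)) as [[d Hd0] Hd1]; simpl in Hd1.
specialize (Hd1 (d / 2) ltac:(lra)).
rewrite Rabs_pos_eq in Hd1 by lra; specialize (Hd1 ltac:(lra)).
apply Rabs_def2 in Hd1.
specialize (Hinc t (t + d / 2) ltac:(lra) ltac:(lra)).
assert (0 < (y (t + d / 2) - y t) / (d / 2)) by (apply Rdiv_lt_0_compat; lra).
lra.
Qed.

Lemma right_continuous_of_right_derivative (y : R -> R) (T l : R) : y T = 0 ->
  (forall eps, 0 < eps -> exists d, 0 < d /\
     forall h, 0 < h < d -> Rabs ((y (T + h) - y T) / h - l) < eps) ->
  forall eps, 0 < eps -> exists d, 0 < d /\ forall h, 0 < h < d -> Rabs (y (T + h)) < eps.
Proof.
intros HyT Hr eps Heps; destruct (Hr 1 Rlt_0_1) as [d [Hd0 Hd]].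
set (c := Rabs l + 1); assert (Hc : 0 < c) by (unfold c; generalize (Rabs_pos l); lra).
exists (Rmin d (eps / c)); split; [apply Rmin_glb_lt; [easy|now apply Rdiv_lt_0_compat]|].
intros h Hh.
assert (Hh1 : h < d) by (apply Rlt_le_trans with (1 := proj2 Hh), Rmin_l).
assert (Hh2 : h < eps / c) by (apply Rlt_le_trans with (1 := proj2 Hh), Rmin_r).
apply Rlt_div_r in Hh2; [|easy].
specialize (Hd h ltac:(lra)); rewrite HyT in Hd.
set (z := (y (T + h) - 0) / h) in *.
assert (Hy : y (T + h) = z * h) by (unfold z; field; lra).
rewrite Hy, Rabs_mult, (Rabs_pos_eq h) by lra.
assert (Hz : Rabs z <= c).
{ unfold c; replace z with ((z - l) + l) by ring.
  generalize (Rabs_triang (z - l) l); lra. }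
assert (Rabs z * h <= c * h) by (apply Rmult_le_compat_r; lra); lra.
Qed.

(** [yp T] is only a right derivative and [yp] is not known to be continuous at [T]. Bounds valid
    just to the right pass to difference quotients by the mean value theorem, and from there to
    their limit. *)
Lemma right_derivative_bounds (y yp : R -> R) (T D lo hi : R) : 0 < D -> y T = 0 ->
  (forall t, T < t -> derivable_pt_lim y t (yp t)) ->
  (forall eps, 0 < eps -> exists d, 0 < d /\
     forall h, 0 < h < d -> Rabs ((y (T + h) - y T) / h - yp T) < eps) ->
  (forall t, T < t < T + D -> lo <= yp t <= hi) -> lo <= yp T <= hi.
Proof.
intros HD HyT Hd Hr Hb.
assert (Hcont := right_continuous_of_right_derivative y T (yp T) HyT Hr).
assert (Hmvt : forall h, 0 < h < D -> lo * h <= y (T + h) <= hi * h).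
{ intros h Hh.
  (* The interval starts at [T + s], where a two-sided derivative exists; right continuity of [y]
     then allows [s] to tend to [0]. *)
  assert (Hstep : forall s, 0 < s < h -> lo * (h - s) <= y (T + h) - y (T + s) <= hi * (h - s)).
  { intros s Hs.
    destruct (MVT_cor2 y yp (T + s) (T + h)) as [c [Hc1 Hc2]]; [lra|intros c Hc; apply Hd; lra|].
    specialize (Hb c ltac:(lra)).
    replace (T + h - (T + s)) with (h - s) in Hc1 by ring; rewrite Hc1.
    split; apply Rmult_le_compat_r; lra. }
  assert (Hlim : forall e, 0 < e -> lo * h - e <= y (T + h) <= hi * h + e).
  { intros e He.
    destruct (Hcont (e / 2)) as [d [Hd0 Hd1]]; [lra|].
    set (c := Rabs lo + Rabs hi + 1).
    assert (Hlo := Rabs_pos lo); assert (Hhi := Rabs_pos hi).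
    assert (Hc : 0 < c) by (unfold c; lra).
    set (s := Rmin (Rmin (d / 2) (h / 2)) (e / 2 / c)).
    assert (Hs0 : 0 < s) by (repeat apply Rmin_glb_lt; try lra; apply Rdiv_lt_0_compat; lra).
    assert (Hs1 : s <= Rmin (d / 2) (h / 2)) by apply Rmin_l.
    assert (Hs2 : s <= e / 2 / c) by apply Rmin_r.
    assert (Hs3 := Rle_trans _ _ _ Hs1 (Rmin_l _ _)).
    assert (Hs4 := Rle_trans _ _ _ Hs1 (Rmin_r _ _)).
    apply Rle_div_r in Hs2; [|easy].
    specialize (Hd1 s ltac:(lra)); apply Rabs_def2 in Hd1.
    specialize (Hstep s ltac:(lra)).
    assert (lo * s <= Rabs lo * s) by (apply Rmult_le_compat_r; [lra|apply Rle_abs]).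
    assert (- hi * s <= Rabs hi * s) by (apply Rmult_le_compat_r; [lra|rewrite <- Rabs_Ropp; apply Rle_abs]).
    assert (0 <= Rabs lo * s) by (apply Rmult_le_pos; lra).
    assert (0 <= Rabs hi * s) by (apply Rmult_le_pos; lra).
    unfold c in Hs2; lra. }
  split; apply le_epsilon; intros e He; specialize (Hlim e He); lra. }
assert (Hlim : forall e, 0 < e -> lo - e <= yp T <= hi + e).
{ intros e He; destruct (Hr e He) as [d [Hd0 Hd1]].
  set (h := Rmin d D / 2).
  assert (Hm : 0 < Rmin d D) by now apply Rmin_glb_lt.
  assert (H1 : Rmin d D <= d) by apply Rmin_l; assert (H2 : Rmin d D <= D) by apply Rmin_r.
  assert (Hh : 0 < h < d) by (unfold h; lra).
  assert (HhD : 0 < h < D) by (unfold h; lra).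
  specialize (Hd1 h Hh); specialize (Hmvt h HhD); rewrite HyT, Rminus_0_r in Hd1.
  apply Rabs_def2 in Hd1.
  assert (lo <= y (T + h) / h) by (apply le_div; lra).
  assert (y (T + h) / h <= hi) by (apply Rle_div_l; lra).
  lra. }
split; apply le_epsilon; intros e He; specialize (Hlim e He); lra.
Qed.

Lemma derive_tangent_shift (g g1 : R -> R) (gam G v : R) : 0 < G -> v / G < gam ->
  (forall u, 0 < u -> is_derive g u (g1 u)) ->
  is_derive (fun v => g (gam - v / G) - g gam) v (- g1 (gam - v / G) / G).
Proof.
intros HG Hv D.
apply is_derive_eq with (- / G * g1 (gam - v / G) + 0); [|field; lra].
apply @is_derive_plus; [|apply @is_derive_const].
apply (is_derive_comp g (fun v => gam - v / G) v); [apply D; lra|].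
auto_derive; [easy|field; lra].
Qed.

Lemma tangent_shift_vanishes (g g1 : R -> R) (gam G : R) : 0 < gam -> 0 < G ->
  (forall u, 0 < u -> is_derive g u (g1 u)) ->
  forall e, 0 < e -> exists d, 0 < d /\
    forall v, 0 < v < d -> Rabs (g (gam - v / G) - g gam) < e.
Proof.
intros Hgam HG D e He.
assert (Hc : continuity_pt g gam).
{ apply derivable_continuous_pt; exists (g1 gam); apply is_derive_Reals, D, Hgam. }
destruct (Hc e He) as [d [Hd0 Hd]].
exists (d * G); split; [now apply Rmult_lt_0_compat|]; intros v Hv.
assert (Hv1 : 0 < v / G) by (apply Rdiv_lt_0_compat; lra).
assert (Hv2 : v / G < d) by (apply Rlt_div_l; lra).
apply Hd; split; [split; [easy|lra]|].
simpl; unfold R_dist; rewrite Rabs_left; lra.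
Qed.

(* [t0]: at [x = 0] the explicit solution for the tangent of [g] at [gam] has [p = n / 2]. *)
Definition centre (m : nat) (g0 G : R) : R := g0 + INR m * ln (INR m * G / INR (S m)).
Definition scaled_w (m : nat) (t0 G gam : R) (y : R -> R) (x : R) : R :=
  G * (gam - y (t0 - INR m * x)).
Definition scaled_p (m : nat) (t0 G : R) (yp : R -> R) (x : R) : R :=
  G * INR m * yp (t0 - INR m * x).

Lemma bubble_of_shooting (m : nat) (f g g1 y yp : R -> R) (gam T G : R) :
  (1 <= m)%nat -> 0 < gam -> 0 < G ->
  (forall u, 0 < u -> f u = exp (g u)) ->
  (forall u, 0 < u -> is_derive g u (g1 u)) ->
  first_zero y T -> shooting_solution (S m) f gam y yp T ->
  let t0 := centre m (g gam) G in
  bubble m (fun v => g (gam - v / G) - g gam) (fun v => - g1 (gam - v / G) / G)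
    (gam * G) ((t0 - T) / INR m) (scaled_w m t0 G gam y) (scaled_p m t0 G yp).
Proof.
intros Hm Hgam HG Hf Hg [Hfz _] [Hy [Hyp [Hinc [HyT [Hr [Hlim Hlimp]]]]]] t0.
replace (S m - 1)%nat with m in Hyp by lia.
assert (HM : 1 <= INR m) by apply (le_INR 1), Hm.
assert (HN : INR (S m) = INR m + 1) by apply S_INR.
assert (Ht : forall x, x < (t0 - T) / INR m -> T < t0 - INR m * x).
{ intros x Hx; apply Rlt_div_r in Hx; lra. }
assert (Hrange : forall t, T < t -> 0 < y t < gam).
{ intros t Ht'; split; [now apply Hfz|now apply lt_lim_of_increasing with T]. }
assert (Hpnn : forall t, T < t -> 0 <= yp t).
{ intros t Ht'; apply derive_nonneg_of_increasing with y T t; [easy|easy|now apply Hy]. }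
(* If [yp] vanished at [t], then [yp ^ m], whose derivative is negative as [f > 0], would be
   negative at [t + 1], against [yp >= 0]. *)
assert (Hppos : forall t, T < t -> 0 < yp t).
{ intros t Ht'; destruct (Hpnn t Ht') as [H|H]; [easy|exfalso].
  destruct (MVT_cor2 (fun s => yp s ^ m) (fun s => - (f (y s) * exp (- s))) t (t + 1))
    as [c [Hc1 Hc2]]; [lra|intros c Hc; apply Hyp; lra|].
  assert (0 < f (y c) * exp (- c)).
  { rewrite Hf by (apply Hrange; lra); apply Rmult_lt_0_compat; apply exp_pos. }
  assert (0 <= yp (t + 1) ^ m) by (apply pow_le, Hpnn; lra).
  rewrite <- H, pow_i in Hc1 by lia; lra. }
assert (Hfar : forall s, exists x0, forall x, x < x0 -> s < t0 - INR m * x).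
{ intros s; exists ((t0 - s) / INR m); intros x Hx; apply Rlt_div_r in Hx; lra. }
assert (Dt : forall x, is_derive (fun x => t0 - INR m * x) x (- INR m)).
{ intros x; auto_derive; [easy|ring]. }
split.
- exact Hm.
- intros x Hx; unfold scaled_w, scaled_p.
  assert (Dy : is_derive y (t0 - INR m * x) (yp (t0 - INR m * x))).
  { apply is_derive_Reals, Hy, Ht, Hx. }
  assert (Dc := is_derive_comp y _ x _ _ Dy (Dt x)).
  apply is_derive_eq with (0 + - G * (- INR m * yp (t0 - INR m * x)) + 0 * 0); [|ring].
  apply (is_derive_ext (fun x => G * gam + - G * y (t0 - INR m * x) + 0 * 0));
    [intros; cbv beta; lra|].
  apply (is_derive_comb3 (fun _ => G * gam) (fun x => y (t0 - INR m * x)) (fun _ => 0));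
    [apply @is_derive_const|exact Dc|apply @is_derive_const].
- intros x Hx; unfold scaled_p.
  assert (Dy : is_derive (fun s => yp s ^ m) (t0 - INR m * x)
    (- (f (y (t0 - INR m * x)) * exp (- (t0 - INR m * x))))).
  { apply is_derive_Reals, Hyp, Ht, Hx. }
  assert (Dc := is_derive_comp (fun s => yp s ^ m) _ x _ _ Dy (Dt x)).
  set (F := - (f (y (t0 - INR m * x)) * exp (- (t0 - INR m * x)))) in *.
  apply is_derive_eq with (0 + (G * INR m) ^ m * (- INR m * F) + 0 * 0).
  + apply (is_derive_ext (fun x => 0 + (G * INR m) ^ m * yp (t0 - INR m * x) ^ m + 0 * 0)).
    { intros z; cbv beta; rewrite (Rpow_mult_distr (G * INR m)); lra. }
    apply (is_derive_comb3 (fun _ => 0) (fun x => yp (t0 - INR m * x) ^ m) (fun _ => 0));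
      [apply @is_derive_const|exact Dc|apply @is_derive_const].
  + unfold source, scaled_w, F.
    assert (Hyx := Hrange _ (Ht x Hx)).
    replace (gam - G * (gam - y (t0 - INR m * x)) / G) with (y (t0 - INR m * x)) by (field; lra).
    rewrite Hf by easy.
    set (gy := g (y (t0 - INR m * x))).
    (* The last summand exponentiates to [(m G / n)^m], and [n^m] times this is the factor [(G m)^m]
       produced by scaling [yp]. *)
    replace (INR m * x + (gy - g gam)) with (gy + - (t0 - INR m * x) + (t0 - g gam)) by ring.
    rewrite !exp_plus.
    replace (t0 - g gam) with (INR m * ln (INR m * G / INR (S m))) by (unfold t0, centre; ring).
    rewrite exp_INR_mult, exp_ln.
    * unfold Rdiv; rewrite !Rpow_mult_distr, pow_inv; field; apply pow_nonzero; lra.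
    * apply Rdiv_lt_0_compat; [apply Rmult_lt_0_compat|]; lra.
- intros x Hx; unfold scaled_p; apply Rmult_lt_0_compat;
    [apply Rmult_lt_0_compat; lra|now apply Hppos, Ht].
- intros x Hx; unfold scaled_w; assert (Hyx := Hrange _ (Ht x Hx)); split.
  + apply Rmult_lt_0_compat; lra.
  + rewrite (Rmult_comm gam); apply Rmult_lt_compat_l; lra.
- intros e He; destruct (Hlim (e / G)) as [s Hs]; [now apply Rdiv_lt_0_compat|].
  destruct (Hfar s) as [x0 Hx0]; exists x0; intros x Hx; specialize (Hs _ (Hx0 x Hx)).
  unfold scaled_w; rewrite Rabs_mult, Rabs_minus_sym, (Rabs_pos_eq G) by lra.
  apply Rlt_div_r in Hs; lra.
- intros e He; destruct (Hlimp (e / (G * INR m))) as [s Hs].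
  { apply Rdiv_lt_0_compat; [easy|apply Rmult_lt_0_compat; lra]. }
  destruct (Hfar s) as [x0 Hx0]; exists x0; intros x Hx; specialize (Hs _ (Hx0 x Hx)).
  unfold scaled_p; rewrite Rabs_mult, (Rabs_pos_eq (G * INR m)) by (apply Rmult_le_pos; lra).
  rewrite Rminus_0_r in Hs; apply Rlt_div_r in Hs; [lra|apply Rmult_lt_0_compat; lra].
- intros e He.
  destruct (right_continuous_of_right_derivative y T (yp T) HyT Hr (e / G)) as [d [Hd0 Hd]];
    [now apply Rdiv_lt_0_compat|].
  exists (d / INR m); split; [apply Rdiv_lt_0_compat; lra|]; intros x Hx.
  assert (HxT := Ht x (proj2 Hx)).
  assert (Hxd : t0 - INR m * x - T < d).
  { assert ((t0 - T - d) / INR m < x) by (unfold Rdiv in *; lra).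
    apply Rlt_div_l in H; lra. }
  specialize (Hd (t0 - INR m * x - T) ltac:(lra)).
  replace (T + (t0 - INR m * x - T)) with (t0 - INR m * x) in Hd by ring.
  apply Rlt_div_r in Hd; [|easy].
  generalize (Rle_abs (y (t0 - INR m * x))); intros Habs.
  unfold scaled_w; replace (gam * G - G * (gam - y (t0 - INR m * x)))
    with (y (t0 - INR m * x) * G) by ring.
  apply Rle_lt_trans with (2 := Hd), Rmult_le_compat_r; lra.
- intros v Hv; apply derive_tangent_shift; [easy|apply Rlt_div_l; lra|easy].
- exact (tangent_shift_vanishes g g1 gam G Hgam HG Hg).
Qed.

(** * Growth of [g] *)

Definition ev (P : R -> Prop) : Prop := exists M, forall x, M < x -> P x.

Lemma ev_and P Q : ev P -> ev Q -> ev (fun x => P x /\ Q x).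
Proof.
intros [M1 H1] [M2 H2]; exists (Rmax M1 M2); intros x Hx; split.
- apply H1, Rle_lt_trans with (2 := Hx), Rmax_l.
- apply H2, Rle_lt_trans with (2 := Hx), Rmax_r.
Qed.

Lemma ev_imp (P Q : R -> Prop) : ev P -> (forall x, P x -> Q x) -> ev Q.
Proof. intros [M H] HPQ; exists M; intros x Hx; now apply HPQ, H. Qed.

Lemma ev_gt K : ev (fun x => K < x).
Proof. now exists K. Qed.

Lemma ev_Rpower_ge s K : 0 < s -> ev (fun x => K <= Rpower x s).
Proof.
intros Hs; set (k := Rmax K 1).
assert (Hk : 0 < k) by (apply Rlt_le_trans with 1; [lra|apply Rmax_r]).
exists (exp (ln k / s)); intros x Hx.
apply Rle_trans with k; [apply Rmax_l|].
rewrite <- (exp_ln k) by easy; apply exp_le.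
assert (Hx0 : 0 < x) by (apply Rlt_trans with (2 := Hx), exp_pos).
assert (ln k / s <= ln x).
{ rewrite <- (ln_exp (ln k / s)); left; apply ln_increasing; [apply exp_pos|easy]. }
apply Rle_div_l in H; lra.
Qed.

Lemma ev_small_ratio (r : R -> R) s d : lim_infty (fun x => r x / Rpower x s) 0 -> 0 < d ->
  ev (fun x => Rabs (r x) <= d * Rpower x s).
Proof.
intros Hr Hd; destruct (Hr d Hd) as [M HM]; exists M; intros x Hx; specialize (HM x Hx).
assert (Hp : 0 < Rpower x s) by apply exp_pos.
rewrite Rminus_0_r in HM; unfold Rdiv in HM.
rewrite Rabs_mult, (Rabs_pos_eq (/ _)) in HM by (left; now apply Rinv_0_lt_compat).
left; apply Rmult_lt_reg_r with (/ Rpower x s); [now apply Rinv_0_lt_compat|].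
apply Rlt_le_trans with (1 := HM); right; field; lra.
Qed.

Lemma pow_le_exp (k : nat) z : (1 <= k)%nat -> 0 <= z -> (z / INR k) ^ k <= exp z.
Proof.
intros Hk Hz.
assert (HK : 0 < INR k) by (apply lt_0_INR; lia).
replace z with (INR k * (z / INR k)) at 2 by (field; lra).
rewrite exp_INR_mult; apply pow_incr; split.
- apply le_div; lra.
- generalize (exp_ineq1_le (z / INR k)); lra.
Qed.

(** The power [8] is what [tail_small] consumes. The exponential is bounded through its 18th power
    estimate, because [(sqrt x)^18 = x^9] leaves one spare factor [x] to absorb the constant. *)
Lemma ev_exp_sqrt_small (K c : R) : 0 < K -> 0 < c ->
  ev (fun x => K * x ^ 8 * exp (- sqrt x / c) <= 1).
Proof.
intros HK Hc.
apply ev_imp with (1 := ev_and _ _ (ev_gt 1) (ev_gt (K * (c * 18) ^ 18))).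
intros x [Hx1 Hx].
assert (Hsq : 0 < sqrt x) by (apply sqrt_lt_R0; lra).
assert (H1 := pow_le_exp 18 (sqrt x / c) ltac:(lia) ltac:(apply le_div; lra)).
replace (INR 18) with 18 in H1 by (simpl; lra).
assert (H2 : (sqrt x / c / 18) ^ 18 = x ^ 9 / (c * 18) ^ 18).
{ replace (sqrt x / c / 18) with (sqrt x * / (c * 18)) by (field; lra).
  rewrite Rpow_mult_distr, pow_inv.
  change 18%nat with (2 * 9)%nat at 1; rewrite pow_mult.
  replace (sqrt x ^ 2) with x by (simpl; rewrite Rmult_1_r, sqrt_sqrt; lra).
  reflexivity. }
rewrite H2 in H1.
assert (Hc18 : 0 < (c * 18) ^ 18) by (apply pow_lt; lra).
assert (Hx8 : 0 < x ^ 8) by (apply pow_lt; lra).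
apply Rle_trans with (exp (sqrt x / c) * exp (- sqrt x / c)).
- apply Rmult_le_compat_r; [left; apply exp_pos|].
  apply Rle_trans with (2 := H1), le_div; [easy|].
  replace (x ^ 9) with (x * x ^ 8) by ring.
  replace (K * x ^ 8 * (c * 18) ^ 18) with (K * (c * 18) ^ 18 * x ^ 8) by ring.
  apply Rmult_le_compat_r; lra.
- rewrite <- exp_plus; right; rewrite <- exp_0; f_equal; field; lra.
Qed.

Lemma convex_max (psi psi1 psi2 : R -> R) (c d u M : R) : c <= u <= d ->
  (forall x, c <= x <= d -> is_derive psi x (psi1 x)) ->
  (forall x, c <= x <= d -> is_derive psi1 x (psi2 x)) ->
  (forall x, c <= x <= d -> 0 <= psi2 x) ->
  psi c <= M -> psi d <= M -> psi u <= M.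
Proof.
intros Hu D1 D2 Hpos Hc Hd.
destruct (Rle_lt_dec (psi u) M) as [H|H]; [easy|exfalso].
assert (Hcu : c < u) by (destruct (proj1 Hu) as [Hlt|Heq]; [easy|subst; lra]).
assert (Hud : u < d) by (destruct (proj2 Hu) as [Hlt|Heq]; [easy|subst; lra]).
destruct (MVT_cor2 psi psi1 c u Hcu) as [x1 [H1 Hx1]].
{ intros x Hx; apply is_derive_Reals, D1; lra. }
destruct (MVT_cor2 psi psi1 u d Hud) as [x2 [H2 Hx2]].
{ intros x Hx; apply is_derive_Reals, D1; lra. }
assert (Hmono : psi1 x1 <= psi1 x2).
{ apply increasing_of_derive with psi2; [| |lra]; intros x Hx; [apply D2|apply Hpos]; lra. }
assert (0 < psi1 x1).
{ destruct (Rlt_le_dec 0 (psi1 x1)) as [Hp|Hp]; [easy|].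
  assert (0 <= - psi1 x1 * (u - c)) by (apply Rmult_le_pos; lra); lra. }
assert (0 < psi1 x2 * (d - u)) by (apply Rmult_lt_0_compat; lra).
lra.
Qed.

Lemma bounded_of_cont_on_nonneg f K : cont_on_nonneg f -> 0 <= K ->
  exists C, 0 <= C /\ forall u, 0 <= u <= K -> f u <= C.
Proof.
intros Hf HK.
(* Composing with [Rabs] yields continuity on both sides of [0], as [continuity_ab_maj] asks. *)
assert (Hc : forall x, continuity_pt (fun u => f (Rabs u)) x).
{ intros x e He; destruct (Hf (Rabs x) (Rabs_pos x) e He) as [d [Hd0 Hd]].
  exists d; split; [easy|]; intros z [_ Hz]; apply Hd; [apply Rabs_pos|].
  apply Rle_lt_trans with (1 := Rabs_triang_inv2 _ _), Hz. }
destruct (continuity_ab_maj (fun u => f (Rabs u)) 0 K HK) as [x [Hx _]]; [intros; apply Hc|].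
exists (Rabs (f (Rabs x))); split; [apply Rabs_pos|]; intros u Hu.
specialize (Hx u Hu); rewrite (Rabs_pos_eq u) in Hx by lra.
apply Rle_trans with (1 := Hx), Rle_abs.
Qed.

Lemma derive_Rpower s x : 0 < x -> is_derive (fun u => Rpower u s) x (s * Rpower x (s - 1)).
Proof. intros Hx; apply is_derive_Reals; now apply derivable_pt_lim_power. Qed.

Lemma Rpower_succ x s : 0 < x -> x * Rpower x (s - 1) = Rpower x s.
Proof.
intros Hx; rewrite <- (Rpower_1 x) at 1 by easy; rewrite <- Rpower_plus; f_equal; ring.
Qed.

Definition g3fun (a q : R) (rho3 : R -> R) (u : R) : R :=
  a * q * (q - 1) * (q - 2) * Rpower u (q - 3) + rho3 u.

Section Growth.
Context (a q : R) (rho rho1 rho2 rho3 : R -> R).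
Context (Ha : 0 < a) (Hq : 1 < q <= 2) (Hrho : C3_pos rho rho1 rho2 rho3).
Context (H0 : lim_infty (fun x => rho x / Rpower x q) 0)
  (H1 : lim_infty (fun x => rho1 x / Rpower x (q - 1)) 0)
  (H2 : lim_infty (fun x => rho2 x / Rpower x (q - 2)) 0)
  (H3 : lim_infty (fun x => rho3 x / Rpower x (q - 3)) 0).

Let g := gfun a q rho.
Let g1 := g1fun a q rho1.
Let g2 := g2fun a q rho2.
Let g3 := g3fun a q rho3.

Lemma derive_gfun u : 0 < u -> is_derive g u (g1 u).
Proof.
intros Hu.
apply is_derive_eq with (0 + a * (q * Rpower u (q - 1)) + 1 * rho1 u);
  [|unfold g1, g1fun; ring].
apply (is_derive_ext (fun u => 0 + a * Rpower u q + 1 * rho u));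
  [intros; unfold g, gfun; lra|].
apply (is_derive_comb3 (fun _ => 0) (fun u => Rpower u q) rho);
  [apply @is_derive_const|now apply derive_Rpower|now apply is_derive_Reals, Hrho].
Qed.

Lemma derive_g1fun u : 0 < u -> is_derive g1 u (g2 u).
Proof.
intros Hu.
apply is_derive_eq with (0 + (a * q) * ((q - 1) * Rpower u (q - 1 - 1)) + 1 * rho2 u);
  [|unfold g2, g2fun; replace (q - 1 - 1) with (q - 2) by ring; ring].
apply (is_derive_ext (fun u => 0 + (a * q) * Rpower u (q - 1) + 1 * rho1 u));
  [intros; unfold g1, g1fun; lra|].
apply (is_derive_comb3 (fun _ => 0) (fun u => Rpower u (q - 1)) rho1);
  [apply @is_derive_const|now apply derive_Rpower|now apply is_derive_Reals, Hrho].
Qed.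

Lemma derive_g2fun u : 0 < u -> is_derive g2 u (g3 u).
Proof.
intros Hu.
apply is_derive_eq with
  (0 + (a * q * (q - 1)) * ((q - 2) * Rpower u (q - 2 - 1)) + 1 * rho3 u);
  [|unfold g3, g3fun; replace (q - 2 - 1) with (q - 3) by ring; ring].
apply (is_derive_ext (fun u => 0 + (a * q * (q - 1)) * Rpower u (q - 2) + 1 * rho2 u));
  [intros; unfold g2, g2fun; lra|].
apply (is_derive_comb3 (fun _ => 0) (fun u => Rpower u (q - 2)) rho2);
  [apply @is_derive_const|now apply derive_Rpower|now apply is_derive_Reals, Hrho].
Qed.

Let Haq : 0 < a * q.
Proof. apply Rmult_lt_0_compat; lra. Qed.

Let Haq1 : 0 < a * q * (q - 1).
Proof. apply Rmult_lt_0_compat; lra. Qed.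

Lemma ev_g_bounds d : 0 < d ->
  ev (fun x => (a - d) * Rpower x q <= g x <= (a + d) * Rpower x q).
Proof.
intros Hd; apply ev_imp with (1 := ev_small_ratio _ _ _ H0 Hd); intros x Hx.
apply Rabs_le_between in Hx; unfold g, gfun; lra.
Qed.

Lemma ev_g1_bounds d : 0 < d ->
  ev (fun x => (a * q - d) * Rpower x (q - 1) <= g1 x <= (a * q + d) * Rpower x (q - 1)).
Proof.
intros Hd; apply ev_imp with (1 := ev_small_ratio _ _ _ H1 Hd); intros x Hx.
apply Rabs_le_between in Hx; unfold g1, g1fun; lra.
Qed.

Lemma ev_g2_bounds : ev (fun x =>
  a * q * (q - 1) / 2 * Rpower x (q - 2) <= g2 x <= 2 * (a * q * (q - 1)) * Rpower x (q - 2)).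
Proof.
apply ev_imp with (1 := ev_small_ratio _ _ (a * q * (q - 1) / 2) H2 ltac:(lra)); intros x Hx.
assert (0 < Rpower x (q - 2)) by apply exp_pos.
assert (0 < a * q * (q - 1) * Rpower x (q - 2)) by (apply Rmult_lt_0_compat; lra).
apply Rabs_le_between in Hx; unfold g2, g2fun; lra.
Qed.

Lemma ev_g1_ge K : ev (fun x => K <= g1 x).
Proof.
assert (Hk : 0 < a * q / 2) by lra.
apply ev_imp with (1 := ev_and _ _ (ev_g1_bounds _ Hk) (ev_Rpower_ge (q - 1) (K / (a * q / 2)) ltac:(lra))).
intros x [Hx1 Hx2].
apply Rle_div_l in Hx2; [|lra].
lra.
Qed.

Lemma ev_g1_le : exists C, 0 < C /\ ev (fun x => g1 x <= C * x).
Proof.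
exists (2 * (a * q)); split; [lra|].
apply ev_imp with (1 := ev_and _ _ (ev_g1_bounds _ Haq) (ev_gt 1)); intros x [Hx1 Hx2].
apply Rle_trans with (1 := proj2 Hx1).
apply Rle_trans with ((a * q + a * q) * Rpower x 1); [|rewrite Rpower_1; lra].
apply Rmult_le_compat_l; [lra|apply Rle_Rpower; lra].
Qed.

(** Up to a factor [2] each, [x g''] is at most [a q (q - 1) x^(q-1)] and [g'] at least
    [a q x^(q-1)]; with [q - 1 <= 1] this gives [4]. Positivity is the convexity used in the outer
    region. *)
Lemma ev_g2_le : ev (fun x => 0 < g2 x /\ x * g2 x <= 4 * g1 x).
Proof.
assert (Hk : 0 < a * q / 2) by lra.
apply ev_imp with (1 := ev_and _ _ (ev_and _ _ ev_g2_bounds (ev_g1_bounds _ Hk)) (ev_gt 1)).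
intros x [[Hx2 Hx1] Hx].
assert (Hp2 : 0 < Rpower x (q - 2)) by apply exp_pos.
assert (Hp1 := Rpower_succ x (q - 1) ltac:(lra)).
replace (q - 1 - 1) with (q - 2) in Hp1 by ring.
split.
- apply Rlt_le_trans with (2 := proj1 Hx2); apply Rmult_lt_0_compat; lra.
- assert (Hle : x * g2 x <= x * (2 * (a * q * (q - 1)) * Rpower x (q - 2)))
    by (apply Rmult_le_compat_l; lra).
  replace (x * (2 * (a * q * (q - 1)) * Rpower x (q - 2)))
    with (2 * (a * q * (q - 1)) * (x * Rpower x (q - 2))) in Hle by ring.
  rewrite Hp1 in Hle.
  assert (Hp0 : 0 < Rpower x (q - 1)) by apply exp_pos.
  assert ((a * q) * (q - 1) * Rpower x (q - 1) <= (a * q) * 1 * Rpower x (q - 1)).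
  { apply Rmult_le_compat_r; [lra|]; apply Rmult_le_compat_l; lra. }
  lra.
Qed.

Lemma ev_g2_ge : exists c, 0 < c /\ ev (fun x => c / x <= g2 x).
Proof.
exists (a * q * (q - 1) / 2); split; [lra|].
apply ev_imp with (1 := ev_and _ _ ev_g2_bounds (ev_gt 1)); intros x [Hx1 Hx2].
apply Rle_trans with (2 := proj1 Hx1); apply Rmult_le_compat_l; [lra|].
replace (/ x) with (Rpower x (- (1))) by (rewrite Rpower_Ropp, Rpower_1; lra).
apply Rle_Rpower; lra.
Qed.

(** Makes the relative variation of [g''] over a distance [gam / G] of order [1 / G], the accuracy
    [zeta]. The uniform range [[x / 2, x]] is needed because the intermediate point of a mean value
    step is unknown. *)
Lemma ev_g3_le : exists C, 0 < C /\
  ev (fun x => forall u, x / 2 <= u <= x -> Rabs (g3 u) <= C * g2 x / x).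
Proof.
set (A := a * q * (q - 1)) in *.
set (C3 := A * Rabs (q - 2) + 1).
assert (HC3 : 0 < C3).
{ unfold C3; assert (0 <= A * Rabs (q - 2)) by (apply Rmult_le_pos; [lra|apply Rabs_pos]); lra. }
exists (16 * C3 / A); split; [apply Rdiv_lt_0_compat; lra|].
destruct (ev_small_ratio _ _ 1 H3 Rlt_0_1) as [M HM].
apply ev_imp with (1 := ev_and _ _ (ev_and _ _ ev_g2_bounds (ev_gt 1)) (ev_gt (2 * M))).
intros x [[Hx2 Hx1] HxM] u Hu.
assert (Hg3 : Rabs (g3 u) <= C3 * Rpower u (q - 3)).
{ unfold g3, g3fun; apply Rle_trans with (1 := Rabs_triang _ _).
  assert (Hpu : 0 < Rpower u (q - 3)) by apply exp_pos.
  rewrite !Rabs_mult, (Rabs_pos_eq (Rpower u _)) by lra.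
  rewrite <- !Rabs_mult; fold A; rewrite Rabs_mult, (Rabs_pos_eq A) by lra.
  specialize (HM u ltac:(lra)); unfold C3; lra. }
apply Rle_trans with (1 := Hg3).
assert (Hu3 : Rpower u (q - 3) <= 8 * Rpower x (q - 3)).
{ replace (q - 3) with (- (3 - q)) by ring; rewrite !Rpower_Ropp.
  assert (Hpx : 0 < Rpower x (3 - q)) by apply exp_pos.
  assert (Hpu : Rpower x (3 - q) / 8 <= Rpower u (3 - q)).
  { apply Rle_trans with (Rpower (x / 2) (3 - q)); [|apply Rle_Rpower_l; lra].
    unfold Rdiv at 2; rewrite <- Rpower_mult_distr by lra.
    apply Rmult_le_compat_l; [lra|].
    apply Rle_trans with (Rpower (/ 2) 3).
    - replace 3 with (INR 3) by (simpl; lra); rewrite Rpower_pow by lra; simpl; lra.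
    - unfold Rpower; apply exp_le.
      assert (ln (/ 2) < 0) by (rewrite <- ln_1; apply ln_increasing; lra).
      nra. }
  apply Rle_trans with (/ (Rpower x (3 - q) / 8)).
  - apply Rinv_le_contravar; lra.
  - right; field; lra. }
apply Rle_trans with (C3 * (8 * Rpower x (q - 3))); [apply Rmult_le_compat_l; lra|].
apply le_div; [lra|].
assert (Hp := Rpower_succ x (q - 2) ltac:(lra)).
replace (q - 2 - 1) with (q - 3) in Hp by ring.
replace (C3 * (8 * Rpower x (q - 3)) * x) with (C3 * 8 * (x * Rpower x (q - 3))) by ring.
rewrite Hp.
apply Rle_trans with (16 * C3 / A * (A / 2 * Rpower x (q - 2))); [right; field; lra|].
apply Rmult_le_compat_l; [left; apply Rdiv_lt_0_compat; lra|apply Hx2].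
Qed.

(** The ratio [e] with [e^(q-1) = 1 / 16]. For large [u <= e x] it gives
    [g(u) <= 2 a u^q <= a u x^(q-1) / 8], hence [g(u) <= g'(x) u / 4]. *)
Definition cut_ratio : R := Rpower (1 / 16) (/ (q - 1)).

Lemma cut_ratio_pow : Rpower cut_ratio (q - 1) = 1 / 16.
Proof.
unfold cut_ratio; rewrite Rpower_mult, Rinv_l by lra; apply Rpower_1; lra.
Qed.

Lemma cut_ratio_bounds : 0 < cut_ratio <= 1 / 16.
Proof.
split; [apply exp_pos|].
rewrite <- (Rpower_1 (1 / 16)) by lra.
unfold cut_ratio, Rpower; apply exp_le.
assert (ln (1 / 16) < 0) by (rewrite <- ln_1; apply ln_increasing; lra).
assert (1 <= / (q - 1)) by (rewrite <- Rinv_1; apply Rinv_le_contravar; lra).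
nra.
Qed.

(** Near [0] the asymptotics of [g] say nothing and continuity of [f] supplies the constant; further
    out the choice of [cut_ratio] applies. The rate [1 / 4] is at most half of
    [theta = (n - 1) / n >= 1 / 2], so decay at rate [theta / 2] survives. *)
Lemma ev_f_small_bound (f : R -> R) : cont_on_nonneg f ->
  (forall u, 0 < u -> f u = exp (g u)) ->
  exists C, 0 <= C /\
  ev (fun x => forall u, 0 < u <= cut_ratio * x -> f u <= C * exp (g1 x / 4 * u)).
Proof.
intros Hf Hfe.
destruct (ev_g_bounds _ Ha) as [M HM].
assert (HM0 : 0 <= Rmax M 0) by apply Rmax_r.
destruct (bounded_of_cont_on_nonneg f _ Hf HM0) as [C [HC0 HC]].
exists (C + 1); split; [lra|].
assert (Hk : 0 < a * q / 2) by lra.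
apply ev_imp with (1 := ev_and _ _ (ev_and _ _ (ev_g1_bounds _ Hk) (ev_g1_ge 0)) (ev_gt 1)).
intros x [[Hx1 HG] Hx] u Hu.
assert (He : 1 <= exp (g1 x / 4 * u)).
{ rewrite <- exp_0; apply exp_le, Rmult_le_pos; lra. }
destruct (Rle_lt_dec u (Rmax M 0)) as [Hu0|Hu0].
- specialize (HC u ltac:(lra)).
  assert ((C + 1) * 1 <= (C + 1) * exp (g1 x / 4 * u)) by (apply Rmult_le_compat_l; lra).
  lra.
- assert (HuM : M < u) by (apply Rle_lt_trans with (2 := Hu0), Rmax_l).
  specialize (HM u HuM).
  rewrite Hfe by lra.
  apply Rle_trans with (1 * exp (g1 x / 4 * u)); [|apply Rmult_le_compat_r; lra].
  rewrite Rmult_1_l; apply exp_le.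
  apply Rle_trans with (1 := proj2 HM).
  rewrite <- (Rpower_succ u q) by lra.
  assert (Hpu : Rpower u (q - 1) <= 1 / 16 * Rpower x (q - 1)).
  { rewrite <- cut_ratio_pow, Rpower_mult_distr by (try apply cut_ratio_bounds; lra).
    apply Rle_Rpower_l; lra. }
  assert (Hp0 : 0 < Rpower x (q - 1)) by apply exp_pos.
  assert (Haq' : a * Rpower x (q - 1) <= a * q * Rpower x (q - 1)).
  { apply Rmult_le_compat_r; [lra|]; rewrite <- (Rmult_1_r a) at 1; apply Rmult_le_compat_l; lra. }
  replace ((a + a) * (u * Rpower u (q - 1))) with (u * (2 * a * Rpower u (q - 1))) by ring.
  rewrite (Rmult_comm _ u); apply Rmult_le_compat_l; [lra|].
  assert (a * Rpower u (q - 1) <= a * (1 / 16 * Rpower x (q - 1))) by (apply Rmult_le_compat_l; lra).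
  lra.
Qed.

(** To leading order the left side is [a x^q (e / 16 - 1 + theta q (1 - e))]. In the critical case
    [theta q = 1] the terms of order one cancel and only [- (15 / 16) a e x^q] remains, so the
    tolerance [d = a e / 16] on the asymptotics of [g] and [g'] must be proportional to [e]. *)
Lemma ev_chord_low (theta : R) : 0 <= theta -> theta * q <= 1 -> theta <= 1 ->
  ev (fun x => g (cut_ratio * x) - g x + theta * g1 x * (x - cut_ratio * x) <= - x).
Proof.
intros Hth Hthq Hth1.
assert (He := cut_ratio_bounds).
set (e := cut_ratio) in *.
set (d := a * e / 16).
assert (Hd : 0 < d) by (unfold d; assert (0 < a * e) by (apply Rmult_lt_0_compat; lra); lra).
destruct (ev_g_bounds d Hd) as [M HM].
apply ev_imp with (1 := ev_and _ _ (ev_and _ _ (ev_g1_bounds _ Hd) (ev_Rpower_ge (q - 1) (2 / (a * e)) ltac:(lra)))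
  (ev_and _ _ (ev_gt 1) (ev_gt (Rmax M 0 / e)))).
intros x [[Hx1 Hlarge] [Hx HxM]].
assert (HxM' : Rmax M 0 < x * e) by (apply Rlt_div_l in HxM; lra).
assert (HM0 : M <= Rmax M 0) by apply Rmax_l.
assert (H00 : 0 <= Rmax M 0) by apply Rmax_r.
assert (Hxe : x * e <= x * 1) by (apply Rmult_le_compat_l; lra).
assert (Hg0 := HM x ltac:(lra)); assert (Hge := HM (e * x) ltac:(lra)).
assert (Hpe : Rpower (e * x) q = e / 16 * Rpower x q).
{ rewrite <- Rpower_mult_distr by lra; f_equal.
  rewrite <- (Rpower_succ e q) by lra; fold e; unfold e; rewrite cut_ratio_pow; lra. }
rewrite Hpe in Hge.
assert (Hp1 := Rpower_succ x q ltac:(lra)).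
set (P := Rpower x q) in *.
assert (HP : 0 < P) by apply exp_pos.
assert (Hchord : theta * g1 x * (x - e * x) <= (a + d) * (1 - e) * P).
{ assert (g1 x * x <= (a * q + d) * Rpower x (q - 1) * x) by (apply Rmult_le_compat_r; lra).
  replace ((a * q + d) * Rpower x (q - 1) * x) with ((a * q + d) * (x * Rpower x (q - 1))) in H by ring.
  rewrite Hp1 in H.
  replace (theta * g1 x * (x - e * x)) with (theta * (1 - e) * (g1 x * x)) by ring.
  apply Rle_trans with (theta * (1 - e) * ((a * q + d) * P)).
  - apply Rmult_le_compat_l; [apply Rmult_le_pos; lra|easy].
  - replace (theta * (1 - e) * ((a * q + d) * P)) with ((theta * q * a + theta * d) * ((1 - e) * P)) by ring.
    replace ((a + d) * (1 - e) * P) with ((a + d) * ((1 - e) * P)) by ring.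
    apply Rmult_le_compat_r; [apply Rmult_le_pos; lra|].
    assert (theta * q * a <= 1 * a) by (apply Rmult_le_compat_r; lra).
    assert (theta * d <= 1 * d) by (apply Rmult_le_compat_r; lra).
    lra. }
assert (Hae : 0 < a * e) by (apply Rmult_lt_0_compat; lra).
assert (Hlow : x <= a * e / 2 * P).
{ rewrite <- Hp1; apply Rle_div_l in Hlarge; [|easy].
  assert (x * 2 <= x * (Rpower x (q - 1) * (a * e))) by (apply Rmult_le_compat_l; lra).
  lra. }
assert (Hde : d * e <= d * (1 / 16)) by (apply Rmult_le_compat_l; lra).
assert (0 <= d * e) by (apply Rmult_le_pos; lra).
assert (Hsum : (a + d) * (e / 16) - (a - d) + (a + d) * (1 - e) <= - (a * e / 2)).
{ unfold d in *; lra. }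
apply Rle_trans with (((a + d) * (e / 16) - (a - d) + (a + d) * (1 - e)) * P); [lra|].
apply Rle_trans with (- (a * e / 2) * P); [apply Rmult_le_compat_r; lra|lra].
Qed.

End Growth.

(** * Inner and outer hypotheses for the tangent of [g] at [gam] *)

Lemma sqrt_bounds x : 1 < x -> 1 <= sqrt x <= x /\ sqrt x ^ 2 = x.
Proof.
intros Hx.
assert (H2 : sqrt x ^ 2 = x) by (simpl; rewrite Rmult_1_r, sqrt_sqrt; lra).
assert (H1 : 1 <= sqrt x) by (rewrite <- sqrt_1; apply sqrt_le_1; lra).
assert (sqrt x * 1 <= sqrt x * sqrt x) by (apply Rmult_le_compat_l; lra).
simpl in H2; simpl; lra.
Qed.

(* With [L = sqrt gam], [eps L^2] is of order [1 / G], the accuracy wanted, while [e^(- c L)]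
   still beats every power of [gam]. *)
Lemma near_exponential_tangent (g1 g2 g3 : R -> R) (gam C3 Cz : R) :
  (forall u, 0 < u -> is_derive g1 u (g2 u)) ->
  (forall u, 0 < u -> is_derive g2 u (g3 u)) ->
  1 < gam -> 2 <= g1 gam -> 0 < g2 gam -> gam * g2 gam <= 4 * g1 gam ->
  (forall u, gam / 2 <= u <= gam -> Rabs (g3 u) <= C3 * g2 gam / gam) ->
  16 <= Cz -> 0 <= C3 <= Cz -> Cz / g1 gam <= 1 / 2 ->
  near_exponential (fun v => - g1 (gam - v / g1 gam) / g1 gam)
    (g2 gam / g1 gam ^ 2) (Cz / g1 gam) (sqrt gam).
Proof.
intros D1 D2 Hgam HG Hg2 Hgg Hg3 HCz HC3 Hz.
set (G := g1 gam) in *; set (k := g2 gam) in *.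
destruct (sqrt_bounds gam Hgam) as [HL HL2].
set (L := sqrt gam) in *.
assert (HG2 : 0 < G ^ 2) by (apply pow_lt; lra).
split.
- now apply Rdiv_lt_0_compat.
- split; [left; apply Rdiv_lt_0_compat; lra|easy].
- lra.
- rewrite HL2; apply le_div; [lra|].
  replace (4 * (k / G ^ 2) * gam * G) with (4 * (gam * k) / G) by (field; lra).
  apply Rle_div_l; [lra|].
  assert (16 * G <= Cz * G) by (apply Rmult_le_compat_r; lra); lra.
- intros v Hv.
  assert (HvG : 0 < v / G) by (apply Rdiv_lt_0_compat; lra).
  assert (HvG2 : v / G <= L / 2).
  { unfold Rdiv; apply Rmult_le_compat; [lra|left; apply Rinv_0_lt_compat; lra|lra|].
    apply Rinv_le_contravar; lra. }
  (* This gives [1 + h'(v) = v g''(c) / G^2]. A second mean value step bounds [g''(gam) - g''(c)]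
     relatively by [C3 / G], because [c] is within [v / G <= gam / G] of [gam]. *)
  destruct (MVT_cor2 g1 g2 (gam - v / G) gam) as [c [Hc1 Hc2]]; [lra| |].
  { intros c Hc; apply is_derive_Reals, D1; lra. }
  destruct (MVT_cor2 g2 g3 c gam) as [c' [Hc3 Hc4]]; [lra| |].
  { intros c' Hc; apply is_derive_Reals, D2; lra. }
  fold G in Hc1; fold k in Hc3.
  specialize (Hg3 c' ltac:(lra)).
  assert (Hvar : Rabs (k - g2 c) <= k * (Cz / G)).
  { rewrite Hc3, Rabs_mult, (Rabs_pos_eq (gam - c)) by lra.
    apply Rle_trans with (C3 * k / gam * (gam / G)).
    - apply Rmult_le_compat; [apply Rabs_pos|lra|easy|].
      apply Rle_trans with (v / G); [lra|].
      apply Rmult_le_compat_r; [left; apply Rinv_0_lt_compat|]; lra.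
    - replace (C3 * k / gam * (gam / G)) with (k * (C3 / G)) by (field; lra).
      apply Rmult_le_compat_l; [lra|].
      apply Rmult_le_compat_r; [left; apply Rinv_0_lt_compat|]; lra. }
  apply Rabs_le_between in Hvar.
  assert (Heq : 1 + - g1 (gam - v / G) / G = v / G ^ 2 * g2 c).
  { replace (g1 (gam - v / G)) with (G - g2 c * (v / G)) by lra; field; lra. }
  rewrite Heq.
  assert (Hv2 : 0 <= v / G ^ 2) by (apply le_div; lra).
  set (z := Cz / G) in *.
  replace (k / G ^ 2 * v * (1 - z)) with (v / G ^ 2 * (k - k * z)) by (field; lra).
  replace (k / G ^ 2 * v * (1 + z)) with (v / G ^ 2 * (k + k * z)) by (field; lra).
  split; apply Rmult_le_compat_l; lra.
Qed.

(** For [u = gam - v / G <= e gam] the bound on [f] yields the first term. Otherwise [psi], the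
    exponent as a function of [u], is convex and is controlled at two endpoints: at [e gam] by the
    chord estimate, and at [v = L] by [- (1 - theta) L + eps L^2], where
    [eps L^2 <= zeta / 4 <= (1 - theta) / 2] costs at most half. *)
Lemma outer_bound_tangent (f g g1 g2 : R -> R) (gam C e theta eps zeta : R) :
  (forall u, 0 < u -> f u = exp (g u)) ->
  (forall u, 0 < u -> is_derive g u (g1 u)) ->
  (forall u, 0 < u -> is_derive g1 u (g2 u)) ->
  1 < gam -> 2 <= g1 gam -> 1 / 2 <= theta < 1 ->
  zeta / 2 <= 1 - theta -> 0 <= C -> 0 < e ->
  near_exponential (fun v => - g1 (gam - v / g1 gam) / g1 gam) eps zeta (sqrt gam) ->
  (forall u, 0 < u <= e * gam -> f u <= C * exp (g1 gam / 4 * u)) ->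
  (forall u, e * gam <= u -> 0 <= g2 u) ->
  g (e * gam) - g gam + theta * g1 gam * (gam - e * gam) <= - gam ->
  forall v, sqrt gam <= v < gam * g1 gam ->
    exp (g (gam - v / g1 gam) - g gam + theta * v) <=
    C * exp (- (g gam - theta * gam * g1 gam)) * exp (- (theta / 2) * (gam * g1 gam - v))
    + exp (- ((1 - theta) * sqrt gam / 2)).
Proof.
intros Hf D D1 Hgam HG Hth Hz2 HC He Ne Hsmall Hconv Hchord v Hv.
destruct (sqrt_bounds gam Hgam) as [HL HL2].
set (L := sqrt gam) in *; set (G := g1 gam) in *.
set (u := gam - v / G).
assert (Hvu : v = G * (gam - u)) by (unfold u; field; lra).
assert (Hu0 : 0 < u).
{ assert (v / G < gam) by (apply Rlt_div_l; lra); unfold u; lra. }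
set (psi z := g z - g gam + theta * (G * (gam - z))).
replace (g u - g gam + theta * v) with (psi u) by (unfold psi; rewrite Hvu; ring).
destruct (Rle_lt_dec u (e * gam)) as [Hsm|Hlg].
- specialize (Hsmall u ltac:(lra)); rewrite Hf in Hsmall by easy.
  assert (Hexp : exp (psi u) <= C * exp (- (g gam - theta * gam * G)) * exp (- (theta / 2) * (gam * G - v))).
  { replace (psi u) with (g u + (- (g gam - theta * gam * G) + - theta * (G * u))) by (unfold psi; ring).
    rewrite exp_plus.
    apply Rle_trans with (C * exp (G / 4 * u) * exp (- (g gam - theta * gam * G) + - theta * (G * u))).
    - apply Rmult_le_compat_r; [left; apply exp_pos|easy].
    - rewrite !Rmult_assoc, <- !exp_plus; apply Rmult_le_compat_l; [easy|apply exp_le].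
      replace (gam * G - v) with (G * u) by (rewrite Hvu; ring).
      assert (0 <= G * u) by (apply Rmult_le_pos; lra).
      assert (1 / 2 * (G * u) <= theta * (G * u)) by (apply Rmult_le_compat_r; lra).
      lra. }
  generalize (exp_pos (- ((1 - theta) * L / 2))); lra.
- assert (Hpsi : psi u <= - ((1 - theta) * L / 2)).
  { assert (HuL : u <= gam - L / G).
    { assert (L / G <= v / G); [|unfold u; lra].
      apply Rmult_le_compat_r; [left; apply Rinv_0_lt_compat|]; lra. }
    assert (HegL : 0 < e * gam) by (apply Rmult_lt_0_compat; lra).
    apply (convex_max psi (fun z => g1 z + - theta * G) (fun z => g2 z) (e * gam) (gam - L / G) u); [lra| | | | |].
    - intros z Hz; unfold psi.
      apply is_derive_eq with (g1 z + (theta * G) * (- 1) + 0 * 0); [|ring].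
      apply (is_derive_ext (fun z => g z + (theta * G) * (gam - z) + 0 * 0 + - g gam * 1)).
      { intros; lra. }
      apply is_derive_eq with (g1 z + (theta * G) * (- 1) + 0 * 0 + 0); [|ring].
      apply @is_derive_plus; [|apply @is_derive_const].
      apply (is_derive_comb3 g (fun z => gam - z) (fun _ => 0));
        [apply D; lra|auto_derive; [easy|ring]|apply @is_derive_const].
    - intros z Hz.
      apply is_derive_eq with (g2 z + 0 * 0 + 0 * 0); [|ring].
      apply (is_derive_ext (fun z => g1 z + 0 * 0 + 0 * 0 + - theta * G)); [intros; lra|].
      apply is_derive_eq with (g2 z + 0 * 0 + 0 * 0 + 0); [|ring].
      apply @is_derive_plus; [|apply @is_derive_const].
      apply (is_derive_comb3 g1 (fun _ => 0) (fun _ => 0));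
        [apply D1; lra|apply @is_derive_const|apply @is_derive_const].
    - intros z Hz; apply Hconv; lra.
    - assert ((1 - theta) * L <= 1 * L) by (apply Rmult_le_compat_r; lra).
      unfold psi; rewrite <- Rmult_assoc; lra.
    - assert (HLW : L < gam * G) by lra.
      assert (Hb := near_exponential_bounds (fun v => g (gam - v / G) - g gam)
        (fun v => - g1 (gam - v / G) / G) eps zeta L (gam * G) Ne HLW).
      destruct (Hb) with (v := L) as [_ HbL]; [| |lra|].
      + intros z Hz; apply derive_tangent_shift; [lra|apply Rlt_div_l; lra|easy].
      + exact (tangent_shift_vanishes g g1 gam G ltac:(lra) ltac:(lra) D).
      + cbv beta in HbL; unfold psi.
        replace (G * (gam - (gam - L / G))) with L by (field; lra).
        assert (Hsm := ne_small _ _ _ _ Ne).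
        assert ((1 - theta) * 1 <= (1 - theta) * L) by (apply Rmult_le_compat_l; lra).
        lra. }
  apply exp_le in Hpsi.
  assert (0 <= C * exp (- (g gam - theta * gam * G)) * exp (- (theta / 2) * (gam * G - v))).
  { repeat apply Rmult_le_pos; [easy|left; apply exp_pos|left; apply exp_pos]. }
  lra.
Qed.

(** Power count: [(1 + gam G)^2] costs [gam^4], [G^3] costs [gam^3], and the lower bound [c2 / gam]
    on [g''] one more, in total [gam^8]. *)
Lemma tail_small (CG c2 Cz kap gam G k : R) :
  0 < CG -> 0 < c2 -> 0 < Cz -> 1 < gam -> 0 < kap -> 0 < G <= CG * gam -> c2 / gam <= k ->
  (1 + CG) ^ 2 * CG ^ 3 / (c2 * Cz) * gam ^ 8 * kap <= 1 ->
  (1 + gam * G) ^ 2 * kap <= k / G ^ 2 * (Cz / G).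
Proof.
intros HCG Hc2 HCz Hgam Hkap HG Hk Htail.
assert (HG3 : 0 < G ^ 3 <= CG ^ 3 * gam ^ 3).
{ split; [apply pow_lt; lra|]; rewrite <- Rpow_mult_distr; apply pow_incr; lra. }
assert (HW : (1 + gam * G) ^ 2 <= (1 + CG) ^ 2 * gam ^ 4).
{ replace ((1 + CG) ^ 2 * gam ^ 4) with (((1 + CG) * gam ^ 2) ^ 2) by ring.
  assert (0 <= gam * G) by (apply Rmult_le_pos; lra).
  apply pow_incr; split; [lra|].
  assert (gam * G <= gam * (CG * gam)) by (apply Rmult_le_compat_l; lra).
  assert (1 * 1 <= gam * gam) by (apply Rmult_le_compat; lra).
  simpl; lra. }
assert (Hcc : 0 < c2 * Cz) by (apply Rmult_lt_0_compat; lra).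
replace ((1 + CG) ^ 2 * CG ^ 3 / (c2 * Cz) * gam ^ 8 * kap)
  with (((1 + CG) ^ 2 * CG ^ 3 * gam ^ 8 * kap) / (c2 * Cz)) in Htail by (field; lra).
apply Rle_div_l in Htail; [|easy].
replace (k / G ^ 2 * (Cz / G)) with (k * Cz / G ^ 3) by (field; lra).
apply le_div; [easy|].
apply Rle_trans with ((1 + CG) ^ 2 * gam ^ 4 * kap * (CG ^ 3 * gam ^ 3)).
- apply Rmult_le_compat; [|lra| |lra].
  + apply Rmult_le_pos; [apply pow2_ge_0|lra].
  + apply Rmult_le_compat_r; lra.
- apply Rle_trans with (c2 / gam * Cz); [|apply Rmult_le_compat_r; lra].
  replace (c2 / gam * Cz) with (c2 * Cz / gam) by (field; lra).
  apply le_div; [lra|].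
  replace ((1 + CG) ^ 2 * gam ^ 4 * kap * (CG ^ 3 * gam ^ 3) * gam)
    with ((1 + CG) ^ 2 * CG ^ 3 * gam ^ 8 * kap) by ring.
  lra.
Qed.

Theorem theorem2p5 (n : nat) (Hn : (2 <= n)%nat)
  (f fp rho rho1 rho2 rho3 : R -> R) (a q alpha beta b : R)
  (y yp : R -> R -> R) (T : R -> R) :
  cont_on_nonneg f ->
  (forall u, 0 < u -> 0 < f u) ->
  (forall u, 0 < u -> f u = exp (gfun a q rho u)) ->
  0 < a -> 1 < q -> q <= INR n / (INR n - 1) ->
  C3_pos rho rho1 rho2 rho3 ->
  0 < alpha <= 1 -> 0 < beta ->
  bigO_at0 (fun s => f s - f 0) beta ->
  (forall u, 0 < u -> derivable_pt_lim f u (fp u)) ->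
  bigO_at0 fp (alpha - 1) ->
  (* (H1) *)
  lim_infty (fun x => rho x / Rpower x q) 0 ->
  lim_infty (fun x => rho1 x / Rpower x (q - 1)) 0 ->
  lim_infty (fun x => rho2 x / Rpower x (q - 2)) 0 ->
  lim_infty (fun x => rho3 x / Rpower x (q - 3)) 0 ->
  (* (H2) *)
  liminf_ge (fun x => gfun a q rho x - (INR n - 1) / INR n * x * g1fun a q rho1 x) b ->
  (* shooting problem *)
  (forall gam, 0 < gam ->
     first_zero (y gam) (T gam) /\
     shooting_solution n f gam (y gam) (yp gam) (T gam)) ->
  exists gam0 C, 0 < gam0 /\
    forall gam, gam0 < gam ->
      let g := gfun a q rho gam in
      let g' := g1fun a q rho1 gam in
      let g'' := g2fun a q rho2 gam in
      let delta := ln g' in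
      let E := exp (- (g - (INR n - 1) / INR n * gam * g')) in
      Rabs (yp gam (T gam)
            - (INR n / (INR n - 1) * / g'
               + INR n ^ 2 * harm n * g'' / ((INR n - 1) * g' ^ 3)))
        <= C * (delta ^ 2 * g'' / g' ^ 4 + E / g')
      /\
      Rabs (T gam
            - ((g - (INR n - 1) / INR n * gam * g')
               + (INR n - 1) * ln ((INR n - 1) / INR n * g')
               + harm n * (INR n - 1) * gam * g'' / g'))
        <= C * ((ln g') ^ 2 / g' + Rpower (ln g') (beta + 1) / Rpower g' beta + E).
Proof.
intros Hf _ Hfe Ha Hq1 Hq2 Hrho _ _ _ _ _ H0 H1 H2 H3 _ Hshoot.
destruct n as [|m]; [lia|].
assert (Hm : (1 <= m)%nat) by lia.
assert (HM : 1 <= INR m) by apply (le_INR 1), Hm.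
assert (HN : INR (S m) = INR m + 1) by apply S_INR.
replace (INR (S m) - 1) with (INR m) in * by lra.
set (theta := INR m / INR (S m)).
assert (Hth : 1 / 2 <= theta < 1) by (unfold theta; split; [apply le_div; lra|apply Rlt_div_l; lra]).
assert (Hth1 : 1 - theta = / INR (S m)) by (unfold theta; rewrite HN; field; lra).
assert (Hthq : theta * q <= 1).
{ apply Rle_div_r in Hq2; [|lra]; unfold theta.
  replace (INR m / INR (S m) * q) with (q * INR m / INR (S m)) by (field; lra).
  apply Rle_div_l; lra. }
assert (Hq : 1 < q <= 2) by (split; [easy|]; nra).
assert (D0 := derive_gfun a q rho rho1 rho2 rho3 Hrho).
assert (D1 := derive_g1fun a q rho rho1 rho2 rho3 Hrho).
assert (D2 := derive_g2fun a q rho rho1 rho2 rho3 Hrho).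
destruct (ev_g1_le a q rho1 Ha Hq H1) as [CG [HCG HevCG]].
destruct (ev_g2_ge a q rho2 Ha Hq H2) as [c2 [Hc2 Hevc2]].
destruct (ev_g3_le a q rho2 rho3 Ha Hq H2 H3) as [C3 [HC3 HevC3]].
destruct (ev_f_small_bound a q rho rho1 Ha Hq H0 H1 f Hf Hfe) as [A [HA HevA]].
(* The threshold is kept separately, because convexity is needed at every point beyond [e gam] and
   not only at [gam]. *)
destruct (ev_g2_le a q rho1 rho2 Ha Hq H1 H2) as [M2 HM2].
assert (Hchord := ev_chord_low a q rho rho1 Ha Hq H0 H1 theta ltac:(lra) Hthq ltac:(lra)).
assert (He := cut_ratio_bounds q Hq).
set (e := cut_ratio q) in *.
(* [16] secures [4 eps L^2 = 4 gam g'' / G^2 <= 16 / G], and [C3] covers the variation of [g'']. *)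
set (Cz := Rmax 16 C3).
assert (HCz : 16 <= Cz) by apply Rmax_l.
assert (HCz3 : C3 <= Cz) by apply Rmax_r.
(* The bound [4] on [W eps = gam g'' / G] comes from [gam g'' <= 4 g']. *)
destruct (bubble_asymptotics m A 4 HA ltac:(lra)) as [C [HC Hmain]].
assert (HK : 0 < (1 + CG) ^ 2 * CG ^ 3 / (c2 * Cz)).
{ apply Rdiv_lt_0_compat; apply Rmult_lt_0_compat; try apply pow_lt; lra. }
(* The threshold [3 + n Cz] on [g'] provides [ln g' >= 1], through [e <= 3], and [n zeta <= 1]. *)
destruct (ev_and _ _ (ev_and _ _ (ev_and _ _ HevCG Hevc2) (ev_and _ _ HevC3 HevA))
  (ev_and _ _ (ev_and _ _ (ev_g1_ge a q rho1 Ha Hq H1 (3 + INR (S m) * Cz)) Hchord)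
    (ev_and _ _ (ev_exp_sqrt_small _ (2 * INR (S m)) HK ltac:(lra))
      (ev_and _ _ (ev_gt (Rmax 1 M2)) (ev_gt (Rmax M2 0 / e)))))) as [M Hev].
exists (Rmax M 1), (INR m * C * (Cz + 1)); split.
{ apply Rlt_le_trans with 1; [lra|apply Rmax_r]. }
intros gam Hgam.
destruct (Hev gam (Rle_lt_trans _ _ _ (Rmax_l _ _) Hgam))
  as [[[HGle Hkge] [Hg3 Hsmall]] [[HGge Hch] [Htail [Hg1M HgM]]]].
clear Hev HevCG Hevc2 HevC3 HevA Hchord.
assert (Hgam1 : 1 < gam) by (apply Rle_lt_trans with (2 := Hg1M), Rmax_l).
assert (HgamM2 : M2 < gam) by (apply Rle_lt_trans with (2 := Hg1M), Rmax_r).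
destruct (HM2 gam HgamM2) as [Hk0 Hkle].
assert (Hconv : forall u, e * gam <= u -> 0 <= g2fun a q rho2 u).
{ intros u Hu; apply Rlt_div_l in HgM; [|lra].
  assert (M2 <= Rmax M2 0) by apply Rmax_l.
  left; apply HM2; lra. }
destruct (Hshoot gam ltac:(lra)) as [Hfz Hsol].
cbv zeta; unfold theta.
set (g := gfun a q rho) in *; set (G := g1fun a q rho1 gam) in *.
set (k := g2fun a q rho2 gam) in *.
set (N := INR (S m)) in *; set (M0 := INR m) in *.
set (H := harm (S m)).
set (E := exp (- (g gam - M0 / N * gam * G))).
assert (HNCz : 2 * 16 <= N * Cz) by (apply Rmult_le_compat; lra).
assert (HNCz2 : 2 * Cz <= N * Cz) by (apply Rmult_le_compat_r; lra).
assert (HG : 3 <= G) by lra.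
assert (HE : 0 < E) by apply exp_pos.
assert (Hz : Cz / G <= 1 / 2) by (apply Rle_div_l; lra).
assert (HNz : N * (Cz / G) <= 1).
{ replace (N * (Cz / G)) with (N * Cz / G) by (field; lra); apply Rle_div_l; lra. }
assert (Ne : near_exponential (fun v => - g1fun a q rho1 (gam - v / G) / G)
   (k / G ^ 2) (Cz / G) (sqrt gam)).
{ apply (near_exponential_tangent (g1fun a q rho1) (g2fun a q rho2) (g3fun a q rho3) gam C3 Cz);
    try easy; fold G k; lra. }
destruct (sqrt_bounds gam Hgam1) as [HL _].
assert (HW : sqrt gam < gam * G).
{ assert (gam * 3 <= gam * G) by (apply Rmult_le_compat_l; lra); lra. }
set (t0 := centre m (g gam) G).
assert (B := bubble_of_shooting m f g (g1fun a q rho1) (y gam) (yp gam) gam (T gam) G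
  Hm ltac:(lra) ltac:(lra) Hfe D0 Hfz Hsol).
cbv zeta in B; fold t0 M0 in B.
set (X := (t0 - T gam) / M0) in *.
destruct (Hmain _ _ _ _ _ _ _ _ _ E B Ne HW) as [[x1 [Hx1 Hp]] HX].
- exact HNz.
- apply tail_small with CG c2; try easy; try lra; apply exp_pos.
- lra.
- replace (gam * G * (k / G ^ 2)) with (gam * k / G) by (field; lra); apply Rle_div_l; lra.
- intros v Hv.
  assert (Ho := outer_bound_tangent f g (g1fun a q rho1) (g2fun a q rho2) gam A e theta
     (k / G ^ 2) (Cz / G) Hfe D0 D1 Hgam1 ltac:(fold G; lra) Hth).
  assert (HthN : (Cz / G) / 2 <= 1 - theta).
  { rewrite Hth1; apply Rmult_le_reg_l with N; [lra|]; rewrite Rinv_r by lra; lra. }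
  specialize (Ho HthN HA (proj1 He) Ne Hsmall Hconv Hch v Hv).
  fold G in Ho; fold N M0 theta.
  replace (M0 / (2 * N)) with (theta / 2) by (unfold theta; field; lra).
  replace (- sqrt gam / (2 * N)) with (- ((1 - theta) * sqrt gam / 2))
    by (rewrite Hth1; field; lra).
  exact Ho.
- fold N H in Hp, HX.
  assert (Hln : 1 <= ln G ^ 2).
  { assert (1 <= ln G).
    { rewrite <- (ln_exp 1); apply ln_le; [apply exp_pos|].
      apply Rle_trans with 3; [apply exp_le_3|lra]. }
    rewrite <- (pow1 2); apply pow_incr; lra. }
  assert (HMG : 0 < G * M0) by (apply Rmult_lt_0_compat; lra).
  assert (HG4 : 0 < G ^ 4) by (apply pow_lt; lra).
  assert (Hz0 : 0 < Cz / G) by (apply Rdiv_lt_0_compat; lra).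
  assert (HeZ : 0 <= k / G ^ 2 * (Cz / G)).
  { left; apply Rmult_lt_0_compat; [apply Rdiv_lt_0_compat; [lra|apply pow_lt; lra]|lra]. }
  set (tgt := N + N ^ 2 * H * (k / G ^ 2)) in *.
  set (err := C * (k / G ^ 2 * (Cz / G) + E)) in *.
  split.
  + assert (Hb : (tgt - err) / (G * M0) <= yp gam (T gam) <= (tgt + err) / (G * M0)).
    { destruct Hsol as [Hy [_ [_ [HyT [Hr _]]]]].
      apply (right_derivative_bounds (y gam) (yp gam) (T gam) (M0 * (X - x1))); try easy.
      { apply Rmult_lt_0_compat; lra. }
      intros t Ht.
      set (x := (t0 - t) / M0).
      assert (Htx : t = t0 - M0 * x) by (unfold x; field; lra).
      assert (HTX : T gam = t0 - M0 * X) by (unfold X; field; lra).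
      assert (Hx : x1 <= x < X).
      { split; [apply Rmult_le_reg_l with M0|apply Rmult_lt_reg_l with M0]; lra. }
      specialize (Hp x Hx); unfold scaled_p in Hp; fold M0 in Hp; rewrite <- Htx in Hp.
      apply Rabs_le_between in Hp.
      split; [apply Rle_div_l|apply le_div]; lra. }
    replace (N / M0 * / G + N ^ 2 * H * k / (M0 * G ^ 3)) with (tgt / (G * M0))
      by (unfold tgt; field; lra).
    (* Dividing by [G] turns [eps zeta] into [Cz g'' / G^4]; the stated error then follows from
       [ln G >= 1]. *)
    assert (Herr : err / (G * M0) <= M0 * C * (Cz + 1) * (ln G ^ 2 * k / G ^ 4 + E / G)).
    { apply Rle_div_l; [easy|].
      assert (HEG : 0 <= E / G) by (apply le_div; lra).
      assert (Hk4 : 0 <= k / G ^ 4) by (apply le_div; lra).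
      assert (Herr' : err = C * (Cz * (k / G ^ 4) + E / G) * G) by (unfold err; field; lra).
      assert (Hd : k / G ^ 4 <= ln G ^ 2 * k / G ^ 4).
      { apply Rmult_le_compat_r; [left; now apply Rinv_0_lt_compat|].
        rewrite <- (Rmult_1_l k) at 1; apply Rmult_le_compat_r; lra. }
      set (d := ln G ^ 2 * k / G ^ 4) in *.
      assert (Hsum : Cz * (k / G ^ 4) + E / G <= (Cz + 1) * (d + E / G)).
      { assert (Cz * (k / G ^ 4) <= Cz * d) by (apply Rmult_le_compat_l; lra).
        assert (0 <= Cz * (E / G)) by (apply Rmult_le_pos; lra).
        lra. }
      rewrite Herr'.
      replace (M0 * C * (Cz + 1) * (d + E / G) * (G * M0))
        with (M0 * M0 * (C * ((Cz + 1) * (d + E / G)) * G)) by ring.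
      assert (HCd : C * (Cz * (k / G ^ 4) + E / G) * G <= C * ((Cz + 1) * (d + E / G)) * G).
      { apply Rmult_le_compat_r; [lra|apply Rmult_le_compat_l; lra]. }
      assert (0 <= C * ((Cz + 1) * (d + E / G)) * G).
      { repeat apply Rmult_le_pos; lra. }
      assert (1 * 1 <= M0 * M0) by (apply Rmult_le_compat; lra).
      apply Rle_trans with (1 := HCd).
      rewrite <- (Rmult_1_l (C * _ * G)) at 1; apply Rmult_le_compat_r; lra. }
    apply Rle_trans with (2 := Herr), Rabs_le.
    unfold Rdiv in *; lra.
  (* From [T = t0 - m X]: the logarithm comes from [t0], the term [gam g'] from [m W / n], and the
     harmonic term from [m H eps W], which stays bounded but need not be small. *)
  + replace (T gam - (g gam - M0 / N * gam * G + M0 * ln (M0 / N * G) + H * M0 * gam * k / G))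
      with (- M0 * (X - gam * G / N + H * (k / G ^ 2) * (gam * G))).
    2:{ unfold X, t0, centre; fold M0 N.
        replace (M0 / N * G) with (M0 * G / N) by (field; lra).
        field; lra. }
    rewrite Rabs_mult, Rabs_Ropp, (Rabs_pos_eq M0) by lra.
    apply Rle_trans with (M0 * (C * (Cz / G + E))); [apply Rmult_le_compat_l; lra|].
    rewrite !(Rmult_assoc M0), (Rmult_assoc C).
    apply Rmult_le_compat_l; [lra|]; apply Rmult_le_compat_l; [lra|].
    assert (HR : 0 <= Rpower (ln G) (beta + 1) / Rpower G beta).
    { left; apply Rdiv_lt_0_compat; apply exp_pos. }
    assert (HlG : / G <= ln G ^ 2 / G).
    { unfold Rdiv; rewrite <- (Rmult_1_l (/ G)) at 1.
      apply Rmult_le_compat_r; [left; apply Rinv_0_lt_compat|]; lra. }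
    set (r := Rpower _ _ / _) in *; set (l := ln G ^ 2 / G) in *.
    assert (0 < / G) by (apply Rinv_0_lt_compat; lra).
    assert (Cz * / G <= Cz * l) by (apply Rmult_le_compat_l; lra).
    assert (0 <= Cz * r) by (apply Rmult_le_pos; lra).
    assert (0 <= Cz * E) by (apply Rmult_le_pos; lra).
    unfold Rdiv; lra.
Qed.
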